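(* Let $\theta\in[-1,1)$ and $a>-1$. Then there is some $t\in\{a,-\frac1\theta,0\}$ (the value $-\frac1\theta$ being an option only if $\theta\neq 0$) such that for every $y\in[-t,1]$ (with $y\ne \frac1\theta$ in case $t=-\frac1\theta$) the limiting process $M'$ given by $$\lim_{n\to\infty}\mathbb P_y\big((M_k)_{1\le k\le m}\in\cdot\,\big|\,\Omega_n\big)=\mathbb P_y\big((M'_k)_{1\le k\le m}\in\cdot\,\big),\qquad m\in\mathbb N,$$ exists and is a time-homogeneous Markov chain on $[-t,1]$ with reduced transition kernel $$p'(x_1,\mathrm dx_2)=\mathbf 1_S(x_2,x_1)\,\frac{h(x_2)}{h(x_1)}\,\frac1\lambda\,\frac1{a+1}\,\mathrm dx_2,\qquad x_1,x_2\in[-t,1],$$ where $h:\mathbb R\to\mathbb R$ is the unique (up to multiplication with a constant) and positive (on the effective state space) eigenfunction satisfying the eigenvalue equation $$\lambda h(x)=\int_{\{y>\theta x\}\cap[-t,1]}h(y)\,\frac1{a+1}\,\mathrm dy,\qquad x\in\mathbb R,$$ corresponding to the largest eigenvalue $\lambda>0$ of this equation.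
   Context: Let $(X_i)_{i\ge1}$ be i.i.d. random variables uniformly distributed on $[-a,1]$. Set $M_0:=(X_1,0)$ and $M_i:=(X_{i+1},X_i)$ for $i\ge1$; $S:=\{(x_2,x_1)\in[-a,1]^2 : x_2>\theta x_1\}$; $\Omega_n:=\bigcap_{i=1}^n\{M_i\in S\}$; $\mathbb P_y(\cdot):=\mathbb P(\cdot\mid X_1=y)$. That $M'$ is a Markov chain with reduced transition kernel $p'$ means that $M'_k=(Y_{k+1},Y_k)$ for $k\ge1$, where $(Y_k)_{k\ge1}$ is the time-homogeneous Markov chain on $[-t,1]$ with $Y_1=y$ and transition kernel $p'$. An eigenvalue of the displayed equation is a number $\lambda$ for which there is a non-zero function $h$, integrable on $[-t,1]$, satisfying the equation. The effective state space is $[-t,1]$, except that when $-t=\frac1\theta$ (i.e. $t=-\frac1\theta$) the point $\frac1\theta$ is removed and it is $(\frac1\theta,1]$; the kernel $p'(x_1,\cdot)$ is considered for $x_1$ in the effective state space. *)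

(* Defs.v *)
From HB Require Import structures.
From mathcomp Require Import all_boot all_order all_algebra.
From mathcomp Require Import all_classical all_reals all_analysis.

Set Implicit Arguments.
Unset Strict Implicit.
Unset Printing Implicit Defensive.

Import Order.TTheory GRing.Theory Num.Theory.
Import numFieldNormedType.Exports.

Local Open Scope classical_set_scope.
Local Open Scope ring_scope.

Lemma lt_Na1 (R : realType) (a : R) : -1 < a -> - a < 1.
Proof. by rewrite ltrNl. Qed.

(* Random sequences are X_1, X_2, ...; nothing depends on the entry X 0. *)
Definition mutually_independent (R : realType) (d : measure_display)
    (T : measurableType d) (P : probability T R) (X : nat -> {RV P >-> R}) : Prop :=
  forall (s : seq nat) (B : nat -> set R), uniq s -> all (fun i => 0 < i)%N s ->
    (forall i, measurable (B i)) ->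
    P (\bigcap_(i in [set` s]) (X i @^-1` B i)) =
      (\prod_(i <- s) P (X i @^-1` B i))%E.

Definition iid_uniform (R : realType) (d : measure_display) (T : measurableType d)
    (P : probability T R) (a : R) (ha : -1 < a) (X : nat -> {RV P >-> R}) : Prop :=
  mutually_independent X /\
  forall i : nat, (0 < i)%N -> forall B : set R, measurable B ->
    distribution P (X i) B = uniform_prob (lt_Na1 ha) B.

(* Pairs are written (x_2, x_1): the newest value comes first. *)
Definition pair_process (R : realType) (T : Type) (X : nat -> T -> R)
    (i : nat) (w : T) : R * R :=
  if i is 0%N then (X 1%N w, 0) else (X i.+1 w, X i w).

Definition pair_block (R : realType) (T : Type) (X : nat -> T -> R)
    (m : nat) (w : T) : m.-tuple (R * R) :=
  [tuple pair_process X k.+1 w | k < m].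

Definition step_set (R : realType) (theta a : R) : set (R * R) :=
  [set z | z.1 \in `[- a, 1] /\ z.2 \in `[- a, 1] /\ z.1 > theta * z.2].

Definition Omega (R : realType) (theta a : R) (T : Type) (X : nat -> T -> R)
    (n : nat) : set T :=
  \bigcap_(i in [set i | (1 <= i <= n)%N]) [set w | step_set theta a (pair_process X i w)].

(* P( . | X_1 = y) has to make sense for every single y and not just almost
   every y.  As X_1 is independent of (X_2, X_3, ...), its canonical version is
   the law of the sequence (y, X_2, X_3, ...), which is [started_at X y]. *)
Definition started_at (R : realType) (T : Type) (X : nat -> T -> R) (y : R)
    (i : nat) (w : T) : R :=
  if i == 1%N then y else X i w.

Definition prob_Omega (R : realType) (d : measure_display) (T : measurableType d)
    (P : probability T R) (X : nat -> T -> R) (theta a y : R) (n : nat) : R :=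
  fine (P (Omega theta a (started_at X y) n)).

(* P_y((M_k)_{1 <= k <= m} \in A | Omega_n) *)
Definition cond_prob_block (R : realType) (d : measure_display)
    (T : measurableType d) (P : probability T R) (X : nat -> T -> R)
    (theta a y : R) (n m : nat) (A : set (m.-tuple (R * R))) : R :=
  fine (P (@pair_block R T (started_at X y) m @^-1` A
             `&` Omega theta a (started_at X y) n))
  / prob_Omega P X theta a y n.

(* The guard theta != 0 is needed because 0^-1 = 0. *)
Definition state_space (R : realType) (theta t : R) : set R :=
  [set x | x \in `[- t, 1] /\ (theta != 0 -> t = - theta^-1 -> x != theta^-1)].

Definition eigenfunction (R : realType) (theta a t lambda : R) (h : R -> R) : Prop :=
  [/\ (@lebesgue_measure R).-integrable `[- t, 1] (EFin \o h),
      exists x, h x != 0 &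
      forall x : R, lambda * h x =
        \int[@lebesgue_measure R]_(y in [set y | y > theta * x] `&` `[- t, 1])
          (h y * (a + 1)^-1)].

Definition eigenvalue (R : realType) (theta a t lambda : R) : Prop :=
  exists h : R -> R, eigenfunction theta a t lambda h.

Definition largest_eigenvalue (R : realType) (theta a t lambda : R) : Prop :=
  eigenvalue theta a t lambda /\
  forall mu : R, eigenvalue theta a t mu -> mu <= lambda.

Definition reduced_kernel (R : realType) (theta a t lambda : R) (h : R -> R)
    (x1 : R) (B : set R) : \bar R :=
  (\int[@lebesgue_measure R]_(x2 in B `&` `[(- t)%R, 1%R])
     (\1_(step_set theta a) (x2, x1) * (h x2 / h x1) * lambda^-1 * (a + 1)^-1)%:E)%E.

(* The last clause is P(Y_{k+1} \in B | Y_1, ..., Y_k) = p(Y_k, B), integrated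
   over the events of the sigma-algebra generated by Y_1, ..., Y_k. *)
Definition markov_chain (R : realType) (d : measure_display)
    (T : measurableType d) (Q : probability T R) (E : set R) (y : R)
    (p : R.-pker R ~> R) (Y : nat -> {RV Q >-> R}) : Prop :=
  [/\ forall k w, (0 < k)%N -> E (Y k w),
      forall w, Y 1%N w = y &
      forall (k : nat) (A : set (k.-tuple R)) (B : set R),
        (0 < k)%N -> measurable A -> measurable B ->
        let past := [set w | A [tuple Y i.+1 w | i < k]] in
        Q (past `&` Y k.+1 @^-1` B) = (\int[Q]_(w in past) p (Y k w) B)%E].

(* Main.v *)
Require Import Defs.
From HB Require Import structures.
From mathcomp Require Import all_boot all_order all_algebra.
From mathcomp Require Import all_classical all_reals all_analysis measurable_realfun.
From mathcomp Require Import ring lra.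
Import Order.TTheory GRing.Theory Num.Theory.
Import numFieldNormedType.Exports.
Local Open Scope classical_set_scope.
Local Open Scope ring_scope.

(** Write [K f (x)] for the integral of [f / (a + 1)] over the points [y] of an
    interval [J = [b, 1]] with [y > theta x].  Every path allowed by the events
    [Omega n] that starts in [J] stays in [J], if [b] is [- a] for negative
    [theta] and [max 0 (- a)] otherwise.  Hence the probability of [Omega n],
    started at [y] in [J], is [f_n y] with [f_n = K^n 1] (the function [surv n]),
    and everything reduces to the asymptotics of [f_n].

    A positive kernel operator contracts oscillations of ratios as soon as it
    satisfies a Doeblin condition: some power [K^k] is bounded below by a rank-one
    operator [u (x) ell], and bounded above on the [f_n] by a multiple of the
    same operator.  Then the quotients [f_(n+j) / f_n] become constant at a
    geometric rate, uniformly in [j], so [f_n / f_n 1] converges to a limit [h].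
    It satisfies [K h = lambda h] and is comparable to every [f_n] with large
    [n] ([normed_cauchy], [normed_bounds]).  The same contraction, applied
    to an integrable eigenfunction (which is bounded by a multiple of [f_n]),
    excludes eigenvalues above [lambda] and makes the eigenspace of [lambda] one
    dimensional ([eigen_small], [eigen_unique]).

    Both bounds follow from monotonicity, since [K] maps nonnegative functions to
    nondecreasing functions if [theta] is negative and to nonincreasing functions
    otherwise.  For negative [theta], the average of a nondecreasing function over
    an upper part of [J] is at least its average over [J] ([tail_int_chebyshev]),
    and this gives the condition with [k = 2], where [u] is the length of the set of
    successors of [x]; this [u] vanishes where [theta x >= 1], exactly like [h].
    For nonnegative [theta] one has [K f x >= K f 1], so [k = 1] and [u = 1] work
    once [f_n b <= A (f_n 1)] is known.  This Harnack inequality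
    ([harnack_pos]) is obtained by cutting [J] at [b + e]: near [b] the
    operator is too small to compete with the growth of [f_n 1], and above
    [b + e] the value [f_n] is controlled by [f_(n+k) 1] because a path from [1]
    can come that low in [k] steps ([surv_reach]).

    The number [t] is such that [[-t, 1]] consists of the points of [J] with
    [theta x <= 1].  Eigenfunctions vanish where [theta x >= 1], so the equation
    on [[-t, 1]] is the equation on [J], and the effective state space is the set
    of the points of [J] with [theta x < 1] ([state_spaceE]), on which [h] is
    positive.

    The limit chain lives on the given probability space:
    [Y_(k+1) = quantile (Y_k, X_(k+1))], where [quantile (x, _)] is the inverse
    of the tail function of the law [h(y) / (lambda h(x)) dy / (a + 1)] on
    the successors of [x].  Integrating one variable at a time
    ([expectation_step]), the law of [(Y_1, ..., Y_(m+1))] has the density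
    [h(x_(m+1)) / (lambda^m h(y))] on [Omega m] with respect to the law of
    [(y, X_2, ..., X_(m+1))] ([tilted_law]); the law conditioned on [Omega n]
    has the density [f_(n-m)(x_(m+1)) / f_n(y)] there ([survival]), and the second
    density tends boundedly to the first one. *)

Set Implicit Arguments.
Unset Strict Implicit.
Unset Printing Implicit Defensive.

(** * Integrals over upper parts of an interval *)
Section TailIntegral.
Context {R : realType}.
Local Notation leb := (@lebesgue_measure R).
Implicit Types (f g : R -> R) (b p q x y : R).

Definition tail b p : set R := [set y | y > p] `&` `[b, 1].

Definition tail_int b f p : R := \int[leb]_(y in tail b p) f y.

(** Tail integrals depend on [p] only through its projection to [[b, 1]], and the
    projection measures the lengths that occur in the bounds below. *)
Definition clamp b p : R := Num.min 1 (Num.max b p).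

Definition on_int b f : Prop := leb.-integrable `[b, 1] (EFin \o f).

Lemma measurable_tail b p : measurable (tail b p).
Proof.
apply: measurableI => //.
rewrite (_ : [set y | y > p] = `]p, +oo[%classic) //.
by apply/seteqP; split=> y /=; rewrite in_itv/= andbT.
Qed.

Lemma tail_sub b p : tail b p `<=` `[b, 1].
Proof. by move=> y []. Qed.

Lemma on_int_cst b r : on_int b (cst r).
Proof.
apply: measurable_bounded_integrable => //=.
  by rewrite lebesgue_measure_itv/=; case: ifP => _; rewrite ?ltry// -EFinB ltry.
exact: bounded_cst.
Qed.

Lemma on_int_tail b f p : on_int b f -> leb.-integrable (tail b p) (EFin \o f).
Proof.
by move=> fi; apply: integrableS fi => //; [exact: measurable_tail|exact: tail_sub].
Qed.

Lemma eq_tail_int b f g p : (forall y, y \in `[b, 1] -> f y = g y) ->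
  tail_int b f p = tail_int b g p.
Proof.
by move=> fg; apply: eq_Rintegral => y; rewrite inE => -[_ yb]; exact: fg.
Qed.

Lemma tail_int_lin b f g p r s : on_int b f -> on_int b g ->
  tail_int b (fun y => r * f y + s * g y) p = r * tail_int b f p + s * tail_int b g p.
Proof.
move=> fi gi; have mt := measurable_tail b p.
have ft := on_int_tail p fi; have gt := on_int_tail p gi.
have Zint (k : R) (u : R -> R) : leb.-integrable (tail b p) (EFin \o u) ->
    leb.-integrable (tail b p) (EFin \o (fun y => k * u y)).
  move=> ui; have := @integrableZl _ _ _ leb _ mt k _ ui; congr (_.-integrable _ _).
rewrite /tail_int RintegralD// ?RintegralZl//; exact: Zint.
Qed.

Lemma tail_int_ge0 b f p : (forall y, y \in `[b, 1] -> 0 <= f y) -> 0 <= tail_int b f p.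
Proof. by move=> f0; apply: Rintegral_ge0 => y [_ yb]; exact: f0. Qed.

Lemma tail_int_le b f g p : on_int b f -> on_int b g ->
  (forall y, y \in `[b, 1] -> f y <= g y) -> tail_int b f p <= tail_int b g p.
Proof.
move=> fi gi fg; apply: le_Rintegral.
- exact: measurable_tail.
- exact: on_int_tail.
- exact: on_int_tail.
- by move=> y [_ yb]; exact: fg.
Qed.

Lemma tail_int1 b f p : 1 <= p -> tail_int b f p = 0.
Proof.
move=> p1; rewrite /tail_int (_ : tail b p = set0) ?Rintegral_set0//.
apply/seteqP; split=> // y [/= py]; rewrite in_itv/= => /andP[_ y1].
by have := lt_le_trans py y1; rewrite ltNge p1.
Qed.

Lemma clamp_id b p : b <= p <= 1 -> clamp b p = p.
Proof. by move=> /andP[bp p1]; rewrite /clamp (max_idPr bp) (min_idPr p1). Qed.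

Lemma clamp_itv b p : b <= 1 -> b <= clamp b p <= 1.
Proof. by move=> b1; rewrite /clamp ge_min lexx/= le_min b1/= le_max lexx. Qed.

Lemma clamp_homo b p q : p <= q -> clamp b p <= clamp b q.
Proof.
move=> pq; rewrite /clamp le_min !ge_min lexx/= orbC ge_max !le_max lexx/=.
by rewrite pq orbT.
Qed.

Lemma measure_tailD b p q : b <= 1 -> p <= q ->
  leb (tail b p `\` tail b q) = (clamp b q - clamp b p)%:E.
Proof.
move=> b1 pq; have [pb|bp] := ltP p b.
  have cp : clamp b p = b by rewrite /clamp (max_idPl (ltW pb)) (min_idPr b1).
  rewrite (_ : _ `\` _ = [set` Interval (BLeft b) (BRight (Num.min q 1))]).
    rewrite cp; have [bq|qb] := ltP b q; last first.
      have -> : clamp b q = b by rewrite /clamp (max_idPl qb) (min_idPr b1).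
      rewrite subrr; apply/eqP; rewrite eq_le measure_ge0 andbT.
      apply: (@le_trans _ _ (leb [set b])).
        apply: le_measure => //; rewrite ?inE//= => y/=; rewrite in_itv/= le_min.
        by move=> /andP[by_ /andP[yq _]]; apply/le_anti; rewrite by_ (le_trans yq qb).
      by rewrite lebesgue_measure_set1.
    have cq : clamp b q = Num.min q 1.
      by rewrite /clamp (max_idPr (ltW bq)) minC.
    rewrite lebesgue_measure_itv/= cq lte_fin.
    case: ifPn => [_|]; first by rewrite EFinB.
    rewrite -leNgt => h; have /eqP -> : Num.min q 1 == b; last by rewrite subrr.
    by rewrite eq_le h le_min (ltW bq) b1.
  apply/seteqP; split=> y/=; rewrite /tail/= !in_itv/= le_min.
    move=> [[py /andP[by_ y1]] h]; rewrite by_ y1/= andbT leNgt; apply/negP => qy.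
    by apply: h; split=> //; rewrite by_ y1.
  move=> /andP[by_ /andP[yq y1]]; split; first by rewrite by_ y1 (lt_le_trans pb).
  by move=> [qy _]; move: qy; rewrite ltNge yq.
have cp : clamp b p = Num.min 1 p by rewrite /clamp (max_idPr bp).
have cq : clamp b q = Num.min 1 q by rewrite /clamp (max_idPr (le_trans bp pq)).
rewrite (_ : _ `\` _ = [set` Interval (BRight p) (BRight (Num.min q 1))]).
  rewrite lebesgue_measure_itv/= cp cq lte_fin [Num.min 1 q]minC.
  have [p1|p1] := leP 1 p.
    rewrite (min_idPr (le_trans p1 pq)) ltNge p1/=.
    by rewrite subrr.
  case: ifPn => [_|]; first by rewrite EFinB.
  rewrite -leNgt => h; have /eqP -> : Num.min q 1 == p; last by rewrite subrr.
  by rewrite eq_le h le_min pq (ltW p1).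
apply/seteqP; split=> y/=; rewrite /tail/= !in_itv/= le_min.
  move=> [[py /andP[by_ y1]] h]; rewrite py y1/= andbT leNgt; apply/negP => qy.
  by apply: h; split=> //; rewrite by_ y1.
move=> /andP[py /andP[yq y1]]; split; first by rewrite y1 py (le_trans bp (ltW py)).
by move=> [qy _]; move: qy; rewrite ltNge yq.
Qed.

Lemma tail_int_split b f p q : on_int b f -> p <= q ->
  tail_int b f p = \int[leb]_(y in tail b p `\` tail b q) f y + tail_int b f q.
Proof.
move=> fi pq; have sub : tail b q `<=` tail b p.
  by move=> y [/= qy yb]; split => //=; exact: le_lt_trans qy.
have mq := measurable_tail b q; have mp := measurable_tail b p.
have eqU : tail b p = (tail b p `\` tail b q) `|` tail b q by rewrite setUC setDUK.
rewrite /tail_int {1}eqU Rintegral_setU//.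
- exact: measurableD.
- by rewrite -eqU; exact: on_int_tail.
- by apply/disj_setPS => y [[_ h] /h].
Qed.

(** The part of [[b, 1]] between [p] and [q] has length [clamp b q - clamp b p]. *)
Lemma tail_int_bounds b f p q m M : b <= 1 -> on_int b f -> p <= q ->
  (forall y, y \in `[b, 1] -> p < y -> y <= q -> m <= f y <= M) ->
  m * (clamp b q - clamp b p) <= tail_int b f p - tail_int b f q <= M * (clamp b q - clamp b p).
Proof.
move=> b1 fi pq fmM; rewrite (tail_int_split fi pq) addrK.
have mD : measurable (tail b p `\` tail b q).
  by apply: measurableD; exact: measurable_tail.
have cst_int r : leb.-integrable (tail b p `\` tail b q) (EFin \o cst r).
  apply: integrableS (on_int_cst b r) => //.
  by move=> y [[]].
have fD : leb.-integrable (tail b p `\` tail b q) (EFin \o f).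
  by apply: integrableS (on_int_tail p fi) => //; first [exact: measurable_tail|exact: subDsetl].
have Dh y : (tail b p `\` tail b q) y -> m <= f y <= M.
  move=> [[py yb] h]; apply: fmM => //.
  by rewrite leNgt; apply/negP => qy; apply: h; split.
have cE r : \int[leb]_(y in tail b p `\` tail b q) (cst r y) = r * (clamp b q - clamp b p).
  transitivity (r * fine (leb (tail b p `\` tail b q))); first exact: Rintegral_cst.
  by rewrite measure_tailD.
rewrite -!cE; apply/andP; split; apply: le_Rintegral => //= y /Dh /andP[]//.
Qed.

Lemma tail_int_clamp b f p : b <= 1 -> on_int b f -> tail_int b f p = tail_int b f (clamp b p).
Proof.
move=> b1 fi; have [p1|p1] := leP 1 p.
  by rewrite !tail_int1// /clamp le_min lexx/= le_max p1 orbT.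
have [bp|pb] := leP b p; first by rewrite clamp_id// bp ltW.
have -> : clamp b p = b by rewrite /clamp (max_idPl (ltW pb)) (min_idPr b1).
have := @tail_int_bounds b f p b (f b) (f b) b1 fi (ltW pb); case/(_ _)/andP.
  move=> y; rewrite in_itv/= => /andP[by_ _] _ yb.
  by have -> : y = b; [apply/le_anti; rewrite by_ yb|rewrite lexx].
have -> : clamp b p = b by rewrite /clamp (max_idPl (ltW pb)) (min_idPr b1).
rewrite clamp_id ?lexx// subrr mulr0 => h1 h2; apply/eqP; rewrite -subr_eq0 eq_le.
by rewrite h1 h2.
Qed.

Lemma tail_int_anti b f p q : b <= 1 -> on_int b f -> (forall y, y \in `[b, 1] -> 0 <= f y) ->
  p <= q -> tail_int b f q <= tail_int b f p.
Proof.
move=> b1 fi f0 pq; rewrite (tail_int_split fi pq) lerDr; apply: Rintegral_ge0 => y [[_ yb] _].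
exact: f0.
Qed.

Lemma tail_int_ge_mass b f p q m : b <= 1 -> on_int b f -> (forall y, y \in `[b, 1] -> 0 <= f y) ->
  p <= q -> (forall y, y \in `[b, 1] -> p < y -> y <= q -> m <= f y) ->
  m * (clamp b q - clamp b p) <= tail_int b f p.
Proof.
move=> b1 fi f0 pq fm.
rewrite (tail_int_split fi pq) -[leLHS]addr0 lerD//; last exact: tail_int_ge0.
have mD : measurable (tail b p `\` tail b q).
  by apply: measurableD; exact: measurable_tail.
have cE r : \int[leb]_(y in tail b p `\` tail b q) (cst r y) = r * (clamp b q - clamp b p).
  transitivity (r * fine (leb (tail b p `\` tail b q))); first exact: Rintegral_cst.
  by rewrite measure_tailD.
rewrite -cE; apply: le_Rintegral => //.
- apply: integrableS (on_int_cst b m) => //.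
  by move=> y [[]].
- by apply: integrableS (on_int_tail p fi) => //; first [exact: measurable_tail|exact: subDsetl].
- move=> y [[py yb] h]; apply: fm => //.
  by rewrite leNgt; apply/negP => qy; apply: h; split.
Qed.

Lemma tail_int_le_mass b f p M : b <= 1 -> on_int b f ->
  (forall y, y \in `[b, 1] -> f y <= M) -> tail_int b f p <= M * (1 - clamp b p).
Proof.
move=> b1 fi fM.
have int_M : on_int b (fun=> M) by exact: on_int_cst.
apply: le_trans (tail_int_le p fi int_M fM) _.
have [p1|p1] := leP 1 p.
  by rewrite tail_int1// /clamp (min_idPl _) ?subrr ?mulr0// le_max p1 orbT.
have /andP[_] := @tail_int_bounds b (fun=> M) p 1 M M b1 int_M (ltW p1) (fun _ _ _ _ => introT andP (conj (lexx _) (lexx _))).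
by rewrite (tail_int1 b _ (lexx 1)) subr0 (@clamp_id b 1)// b1 lexx.
Qed.

(** For nondecreasing [f] the average over an upper part of [[b, 1]] is at least the
    average over [[b, 1]]: compare both parts with the value of [f] at the cut. *)
Lemma tail_int_chebyshev b f p : b <= 1 -> on_int b f ->
  (forall x y, x \in `[b, 1] -> y \in `[b, 1] -> x <= y -> f x <= f y) ->
  (1 - clamp b p) * tail_int b f b <= (1 - b) * tail_int b f p.
Proof.
move=> b1 fi fnd; rewrite (tail_int_clamp p b1 fi).
set q := clamp b p; have /andP[bq q1] : b <= q <= 1 by exact: clamp_itv.
have qJ : q \in `[b, 1] by rewrite in_itv/= bq q1.
have cb : clamp b b = b by rewrite clamp_id// lexx b1.
have cq : clamp b q = q by rewrite clamp_id// bq q1.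
have c1 : clamp b 1 = 1 by rewrite clamp_id// lexx b1.
have := @tail_int_bounds b f b q (f b) (f q) b1 fi bq; case/(_ _)/andP.
  move=> y yJ by_ yq; rewrite !fnd// ?ltW//.
  by rewrite in_itv/= lexx b1.
rewrite cb cq => _ lo.
have := @tail_int_bounds b f q 1 (f q) (f 1) b1 fi q1; case/(_ _)/andP.
  move=> y yJ qy y1; rewrite !fnd// ?ltW//.
  by rewrite in_itv/= lexx b1.
rewrite cq c1 (tail_int1 b f (lexx _)) subr0 => hi _.
nra.
Qed.

End TailIntegral.

(** * Contraction of oscillations under a Doeblin condition *)
Lemma cvgn_ge {R : realType} (v : nat -> R) (l c : R) :
  v n @[n --> \oo] --> l -> (forall n, c <= v n) -> c <= l.
Proof.
move=> vl cv; rewrite -(cvg_lim _ vl)//; apply: limr_ge; first exact: cvgP vl.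
exact: nearW.
Qed.

Lemma cvgn_le {R : realType} (v : nat -> R) (l c : R) :
  v n @[n --> \oo] --> l -> (forall n, v n <= c) -> l <= c.
Proof.
move=> vl cv; rewrite -(cvg_lim _ vl)//; apply: limr_le; first exact: cvgP vl.
exact: nearW.
Qed.

Section Doeblin.
Context {R : realType} {T : Type}.
Implicit Types (phi psi : nat -> T -> R) (J : set T).

Definition shift n phi : nat -> T -> R := fun i => phi (i + n)%N.

(** The operator [K] is present only through its orbits: [C phi] stands for
    [phi (n + 1) = K (phi n)].  In this way iterates of [K] are never taken on
    functions for which measurability would have to be proved.  The functional
    [ell] acts on orbits, so that it may use a later term of the orbit. *)
Record doeblin J (C : (nat -> T -> R) -> Prop) (k : nat)
    (ell : (nat -> T -> R) -> R) (u : T -> R) : Prop := {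
  chain_lin : forall phi psi r s, C phi -> C psi ->
    C (fun n x => r * phi n x + s * psi n x);
  chain_shift : forall n phi, C phi -> C (shift n phi);
  chain_pos : forall phi, C phi -> (forall x, J x -> 0 <= phi 0%N x) ->
    forall n x, J x -> 0 <= phi n x;
  ell_lin : forall phi psi r s, C phi -> C psi ->
    ell (fun n x => r * phi n x + s * psi n x) = r * ell phi + s * ell psi;
  ell_pos : forall phi, C phi -> (forall x, J x -> 0 <= phi 0%N x) -> 0 <= ell phi;
  doeblin_low : forall phi, C phi -> (forall x, J x -> 0 <= phi 0%N x) ->
    forall x, J x -> u x * ell phi <= phi k x }.

Variables (J : set T) (C : (nat -> T -> R) -> Prop) (k : nat).
Variables (ell : (nat -> T -> R) -> R) (u : T -> R).
Hypotheses (D : doeblin J C k ell u) (k0 : (0 < k)%N).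
Variables (psi : nat -> T -> R) (beta : R).
Hypotheses (Cpsi : C psi) (psi0 : forall n x, J x -> 0 <= psi n x).
Hypotheses (ellpsi : forall n, 0 < ell (shift n psi)) (beta1 : 1 <= beta).
Hypothesis up : forall n x, J x -> psi (n + k)%N x <= beta * (u x * ell (shift n psi)).

Let beta0 : 0 < beta. Proof. exact: lt_le_trans beta1. Qed.
Let delta := 1 - beta^-1.
Let delta_ge0 : 0 <= delta. Proof. by rewrite subr_ge0 invf_le1. Qed.
Let delta_lt1 : delta < 1. Proof. by rewrite gtrBl invr_gt0. Qed.

Definition between phi n (m M : R) := forall x, J x -> m * psi n x <= phi n x <= M * psi n x.

(** With [r] the quotient of the values of [ell] on [phi] and [psi], the lower bound
    for [phi - m psi] gains [(r - m) / beta] and the one for [M psi - phi] gains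
    [(M - r) / beta], so that the width [M - m] loses the fraction [1 / beta]. *)
Lemma between_contract phi n m M : C phi -> between phi n m M ->
  exists m' M', [/\ m <= m', M' <= M, M' - m' = delta * (M - m) &
    between phi (n + k) m' M'].
Proof.
move=> Cphi b.
have Cp := chain_shift D n Cphi; have Cq := chain_shift D n Cpsi.
have Clo : C (fun i x => 1 * shift n phi i x + (- m) * shift n psi i x).
  exact: (chain_lin D).
have Chi : C (fun i x => M * shift n psi i x + (- 1) * shift n phi i x).
  exact: (chain_lin D).
have plo x : J x -> 0 <= 1 * shift n phi 0%N x + (- m) * shift n psi 0%N x.
  by move=> Jx; rewrite /shift add0n; have := b x Jx; lra.
have phi_ x : J x -> 0 <= M * shift n psi 0%N x + (- 1) * shift n phi 0%N x.
  by move=> Jx; rewrite /shift add0n; have := b x Jx; lra.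
have lo0 := ell_pos D Clo plo; have hi0 := ell_pos D Chi phi_.
have lo := doeblin_low D Clo plo; have hi := doeblin_low D Chi phi_.
move: lo0 hi0 lo hi; rewrite !(ell_lin D)//.
set L := ell (shift n phi); set P := ell (shift n psi) => lo0 hi0 lo hi.
have P0 : 0 < P by exact: ellpsi.
pose r := L / P; have LE : L = r * P by rewrite /r divfK// gt_eqF.
have mr : m <= r by rewrite -(ler_pM2r P0) -LE; lra.
have rM : r <= M by rewrite -(ler_pM2r P0) -LE; lra.
have upx x : J x -> psi (n + k)%N x / beta <= u x * P.
  by move=> Jx; rewrite ler_pdivrMr// mulrC; exact: up.
exists (m + (r - m) / beta), (M - (M - r) / beta); split.
- by rewrite lerDl divr_ge0 ?subr_ge0// ltW.
- by rewrite gerBl divr_ge0 ?subr_ge0// ltW.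
- by rewrite /delta; lra.
- move=> x Jx; have := lo x Jx; have := hi x Jx; have := upx x Jx.
  rewrite /shift [(k + n)%N]addnC LE => h1 h2 h3.
  have k1 : (r - m) * (psi (n + k)%N x / beta) <= (r - m) * (u x * P).
    by rewrite ler_wpM2l// subr_ge0.
  have k2 : (M - r) * (psi (n + k)%N x / beta) <= (M - r) * (u x * P).
    by rewrite ler_wpM2l// subr_ge0.
  by apply/andP; split; lra.
Qed.

Lemma between_iter phi n m M i : C phi -> between phi n m M ->
  exists m' M', [/\ m <= m', M' <= M, M' - m' = delta ^+ i * (M - m) &
    between phi (n + i * k) m' M'].
Proof.
move=> Cphi b; elim: i => [|i [m' [M' [mm MM eq b']]]].
  by exists m, M; split => //; rewrite ?expr0 ?mul1r// mul0n addn0.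
have [m2 [M2 [h1 h2 h3 h4]]] := between_contract Cphi b'.
exists m2, M2; split; [exact: le_trans h1|exact: le_trans MM| |].
  by rewrite h3 eq exprS mulrA.
by rewrite mulSn [(k + _)%N]addnC addnA.
Qed.

(** The shifted orbit is itself comparable to [psi] with constants of ratio
    [beta ^+ 2] independent of [j]; this starts the contraction. *)
Lemma between_self j : exists2 s, 0 < s & between (shift j psi) k (s / beta) (s * beta).
Proof.
set e0 := ell (shift 0 psi); set ej := ell (shift j psi).
have e00 : 0 < e0 by exact: ellpsi.
have ej0 : 0 < ej by exact: ellpsi.
have Cj := chain_shift D j Cpsi; have C0 := chain_shift D 0 Cpsi.
exists (ej / e0); first exact: divr_gt0.
move=> x Jx.
have l0 := doeblin_low D C0 (fun z Jz => psi0 0 Jz) Jx.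
have lj := doeblin_low D Cj (fun z Jz => psi0 j Jz) Jx.
have u0 := up 0 Jx; have uj := up j Jx.
move: l0 lj u0 uj; rewrite -/e0 -/ej /shift add0n addn0 [(j + k)%N]addnC => l0 lj u0 uj.
apply/andP; split.
- apply: le_trans lj; rewrite (_ : u x * ej = ej / e0 / beta * (beta * (u x * e0))).
    by rewrite ler_wpM2l// ltW// !divr_gt0.
  by field; rewrite !gt_eqF.
- apply: (le_trans uj); rewrite (_ : beta * _ = ej / e0 * beta * (u x * e0)).
    by rewrite ler_wpM2l// ltW// mulr_gt0// divr_gt0.
  by field; rewrite gt_eqF.
Qed.

Variable x0 : T.
Hypotheses (Jx0 : J x0) (psix0 : forall n, 0 < psi n x0).

Definition normed n x := psi n x / psi n x0.

(** Bounds on a quotient that hold both at the point and at the normalizing point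
    bound the quotient of the normalized values. *)
Lemma normed_close (m M p q p0 q0 : R) : 0 < m -> m <= M -> 0 <= p -> 0 < p0 -> 0 < q0 ->
  m * p <= q <= M * p -> m * p0 <= q0 <= M * p0 ->
  m / M * (p / p0) <= q / q0 <= M / m * (p / p0).
Proof.
move=> m0 mM p_ge0 p00 q00 /andP[h1 h2] /andP[h3 h4].
have M0 : 0 < M by exact: lt_le_trans mM.
have q_ge0 : 0 <= q by rewrite (le_trans _ h1)// mulr_ge0// ltW.
rewrite !mulf_div; apply/andP; split.
  rewrite ler_pdivrMr ?mulr_gt0// mulrAC ler_pdivlMr//.
  by apply: ler_pM => //; rewrite ?mulr_ge0// ltW.
rewrite ler_pdivrMr// mulrAC ler_pdivlMr ?mulr_gt0//.
by apply: ler_pM => //; rewrite mulr_ge0// ltW.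
Qed.

Lemma normed_cauchy i j x : J x ->
  `|normed (k + i * k + j) x - normed (k + i * k) x| <=
  beta ^+ 2 * delta ^+ i * normed (k + i * k) x.
Proof.
move=> Jx; have [s s0 b] := between_self j.
have [m [M [h1 h2 h3 h4]]] := between_iter i (chain_shift D j Cpsi) b.
have m0 : 0 < m by apply: lt_le_trans h1; exact: divr_gt0.
set n := (k + i * k)%N in h4 *.
have mM : m <= M.
  have /andP[a1 a2] := h4 _ Jx0; rewrite -(ler_pM2r (psix0 n)).
  exact: le_trans a2.
have := normed_close m0 mM (psi0 n Jx) (psix0 n) (psix0 (n + j)) (h4 x Jx) (h4 x0 Jx0).
rewrite -/(normed n x) -/(normed (n + j) x) => /andP[g1 g2].
have e0 : 0 <= normed n x by apply: divr_ge0; [exact: psi0|exact: ltW].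
have M0 : 0 < M by exact: lt_le_trans mM.
have key : (M - m) / m <= beta ^+ 2 * delta ^+ i.
  rewrite ler_pdivrMr// h3 (@le_trans _ _ (delta ^+ i * (s * beta)))//.
    by rewrite ler_wpM2l ?exprn_ge0// gerBl divr_ge0// ltW.
  rewrite [beta ^+ 2 * _]mulrC -mulrA ler_wpM2l ?exprn_ge0//.
  have : beta ^+ 2 * (s / beta) <= beta ^+ 2 * m by rewrite ler_wpM2l ?exprn_ge0// ltW.
  by apply: le_trans; rewrite expr2 mulrACA mulrA -[leRHS]mulrA divff ?gt_eqF// mulr1 mulrC.
have key2 : 1 - m / M <= (M - m) / m.
  rewrite (_ : 1 - m / M = (M - m) / M); last by field; rewrite gt_eqF.
  by rewrite ler_wpM2l ?subr_ge0// lef_pV2.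
have key3 : M / m - 1 = (M - m) / m by field; rewrite gt_eqF.
apply: (@le_trans _ _ ((M - m) / m * normed n x)); last by rewrite ler_wpM2r.
rewrite ler_norml; apply/andP; split.
  rewrite lerNl opprB; apply: (@le_trans _ _ ((1 - m / M) * normed n x)).
    by rewrite mulrBl mul1r lerD2l lerN2.
  by rewrite ler_wpM2r.
by rewrite -key3 mulrBl mul1r lerD2r.
Qed.

Lemma normed_bounds j x : J x ->
  normed k x / beta ^+ 2 <= normed (k + j) x <= beta ^+ 2 * normed k x.
Proof.
move=> Jx; have [s s0 b] := between_self j.
have m0 : 0 < s / beta by exact: divr_gt0.
have mM : s / beta <= s * beta.
  rewrite ler_wpM2l ?(ltW s0)//; apply: (le_trans _ beta1).
  by rewrite invf_le1.
have := normed_close m0 mM (psi0 k Jx) (psix0 k) (psix0 (k + j)) (b x Jx) (b x0 Jx0).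
rewrite -/(normed k x) -/(normed (k + j) x).
have -> : s / beta / (s * beta) = (beta ^+ 2)^-1 by field; rewrite !gt_eqF.
have -> : s * beta / (s / beta) = beta ^+ 2 by field; rewrite !gt_eqF.
by rewrite [_ / beta ^+ 2]mulrC.
Qed.

Let cvg_delta : delta ^+ i @[i --> \oo] --> (0 : R).
Proof. by apply: cvg_expr; rewrite ger0_norm. Qed.

Lemma normed_is_cvg x : J x -> cvgn (normed ^~ x).
Proof.
move=> Jx; apply/cauchy_cvgP/cauchy_exP => e e0.
have B0 : 0 <= normed k x by apply: divr_ge0; [exact: psi0|exact: ltW].
pose B := beta ^+ 2 * (beta ^+ 2 * normed k x).
have : B * delta ^+ i @[i --> \oo] --> B * 0 by apply: cvgMr; exact: cvg_delta.
rewrite mulr0 => /cvgr0Pnorm_lt /(_ e e0)[i _ /(_ i (leqnn i))/=].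
have B'0 : 0 <= B * delta ^+ i.
  apply: mulr_ge0; last exact: exprn_ge0.
  by apply: mulr_ge0; [|apply: mulr_ge0 => //]; rewrite exprn_ge0// ltW.
rewrite ger0_norm// => hi.
exists (normed (k + i * k) x); exists (k + i * k)%N => // n /= hn.
rewrite /ball/= distrC -(subnKC hn).
apply: le_lt_trans (normed_cauchy i _ Jx) _.
apply: le_lt_trans hi; rewrite /B mulrAC ler_wpM2r ?exprn_ge0//.
apply: ler_wpM2l; first by rewrite exprn_ge0// (ltW beta0).
by have /andP[] := normed_bounds (i * k) Jx.
Qed.

Section eigen.
Variables (h : T -> R) (lambda : R).
Hypotheses (lambda0 : 0 < lambda) (Ch : C (fun n x => lambda ^+ n * h x)).
Hypothesis hcvg : forall x, J x -> normed ^~ x @ \oo --> h x.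

Lemma limit_bounds x : J x -> normed k x / beta ^+ 2 <= h x <= beta ^+ 2 * normed k x.
Proof.
move=> Jx; have sh : normed (n + k) x @[n --> \oo] --> h x.
  by rewrite (cvg_shiftn k (normed ^~ x)); exact: hcvg.
apply/andP; split.
  apply: (cvgn_ge sh); move=> n; rewrite addnC.
  by have /andP[] := normed_bounds n Jx.
apply: (cvgn_le sh); move=> n; rewrite addnC.
by have /andP[] := normed_bounds n Jx.
Qed.

Let A' := beta ^+ 2 * psi k x0.
Let A'0 : 0 < A'. Proof. by rewrite mulr_gt0// exprn_gt0. Qed.

Lemma psi_le_limit x : J x -> psi k x <= A' * h x.
Proof.
move=> Jx; have /andP[+ _] := limit_bounds Jx.
rewrite ler_pdivrMr ?exprn_gt0// /normed ler_pdivrMr// => /le_trans; apply.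
by rewrite le_eqVlt; apply/orP; left; apply/eqP; rewrite /A'; ring.
Qed.

(** If [g] is bounded by [A psi k], then [mu ^+ n * g] stays below a multiple of
    [lambda ^+ n * h], which is impossible for [mu > lambda] unless [g = 0]. *)
Lemma eigen_small mu g A : C (fun n x => mu ^+ n * g x) -> 0 <= A ->
  (forall x, J x -> `|g x| <= A * psi k x) -> lambda < mu ->
  forall x, J x -> g x = 0.
Proof.
move=> Cg A0 gA lm x Jx.
have gh z : J z -> `|g z| <= A * A' * h z.
  move=> Jz; rewrite -mulrA; apply: le_trans (gA z Jz) _.
  by rewrite ler_wpM2l// psi_le_limit.
have Clo : C (fun n x => (A * A') * (lambda ^+ n * h x) + 1 * (mu ^+ n * g x)).
  exact: (chain_lin D).
have Chi : C (fun n x => (A * A') * (lambda ^+ n * h x) + (- 1) * (mu ^+ n * g x)).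
  exact: (chain_lin D).
have mu0 : 0 < mu by exact: lt_trans lm.
have key n : mu ^+ n * `|g x| <= A * A' * (lambda ^+ n * h x).
  have lo := chain_pos D Clo _ n Jx; have hi := chain_pos D Chi _ n Jx.
  rewrite -[mu ^+ n]gtr0_norm ?exprn_gt0// -normrM ler_norml.
  have := lo _; have := hi _; move=> {lo hi} hi lo.
  have/lo : forall x, J x -> 0 <= A * A' * (lambda ^+ 0 * h x) + 1 * (mu ^+ 0 * g x).
    by move=> z /gh; rewrite !expr0 ler_norml; lra.
  have/hi : forall x, J x -> 0 <= A * A' * (lambda ^+ 0 * h x) + (-1) * (mu ^+ 0 * g x).
    by move=> z /gh; rewrite !expr0 ler_norml; lra.
  lra.
apply/eqP; rewrite -normr_le0.
have cv : A * A' * h x * (lambda / mu) ^+ n @[n --> \oo] --> A * A' * h x * 0.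
  apply: cvgMr; apply: cvg_expr; rewrite ger0_norm ?divr_ge0 ?ltW//.
  by rewrite ltr_pdivrMr// mul1r.
move: cv; rewrite mulr0 => cv.
apply: (cvgn_ge cv); move=> n.
rewrite expr_div_n mulrA ler_pdivlMr ?exprn_gt0// mulrC.
by rewrite -[leRHS]mulrA [h x * _]mulrC.
Qed.

(** Contraction leaves [lambda ^+ n * g] in a band of relative width [delta ^+ i]
    around a multiple of [psi (k + i * k)]; dividing by [lambda ^+ n], of which
    [psi] is at most a multiple, and letting [i] grow gives proportionality. *)
Lemma eigen_unique g A : C (fun n x => lambda ^+ n * g x) -> 0 <= A ->
  (forall x, J x -> `|g x| <= A * psi k x) ->
  forall x, J x -> g x = g x0 * h x.
Proof.
move=> Cg A0 gA x Jx.
pose phi n x := lambda ^- k * (lambda ^+ n * g x) + 0 * (lambda ^+ n * g x).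
have Cphi : C phi by exact: (chain_lin D).
have phiE n z : phi (k + n)%N z = lambda ^+ n * g z.
  by rewrite /phi mul0r addr0 exprD !mulrA mulVf ?mul1r// gt_eqF// exprn_gt0.
have b : between phi k (- A) A.
  by move=> z Jz; rewrite -[k in phi k]addn0 phiE expr0 mul1r mulNr -ler_norml gA.
have psile n z : J z -> psi (k + n)%N z <= A' * (lambda ^+ n * h z).
  move=> Jz.
  have Cc : C (fun n x => A' * (lambda ^+ n * h x) + (-1) * shift k psi n x).
    by apply: (chain_lin D) => //; exact: (chain_shift D).
  have := chain_pos D Cc _ n Jz.
  have h0 : forall z, J z -> 0 <= A' * (lambda ^+ 0 * h z) + (-1) * shift k psi 0%N z.
    by move=> w /psi_le_limit; rewrite /shift add0n expr0; lra.
  by move=> /(_ h0); rewrite /shift addnC; lra.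
have key i : `|g x - g x0 * normed (k + i * k) x| <= 2 * A * A' * h x * delta ^+ i.
  have [m [M [h1 h2 h3 h4]]] := between_iter i Cphi b.
  have := h4 x Jx; have := h4 x0 Jx0; rewrite !phiE.
  have := psile (i * k)%N x Jx.
  set n := (k + i * k)%N; set l := lambda ^+ (i * k) => q1 q2 q3.
  have l0 : 0 < l by exact: exprn_gt0.
  have p0 := psix0 n; have p1 := psi0 n Jx.
  have e0 : 0 <= normed n x by apply: divr_ge0; [exact: psi0|exact: ltW].
  have eE : psi n x = normed n x * psi n x0 by rewrite divfK// gt_eqF.
  have : `|l * (g x - g x0 * normed n x)| <= (M - m) * psi n x.
    have w1 : m * psi n x <= (l * g x0) * normed n x <= M * psi n x.
      have -> : m * psi n x = m * psi n x0 * normed n x by rewrite eE; ring.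
      have -> : M * psi n x = M * psi n x0 * normed n x by rewrite eE; ring.
      by case/andP: q2 => ? ?; rewrite !ler_wpM2r.
    by rewrite ler_norml; lra.
  rewrite normrM gtr0_norm// h3 => q4.
  rewrite -(ler_pM2l l0); apply: (le_trans q4).
  rewrite (_ : l * _ = delta ^+ i * (A - - A) * (A' * (l * h x))); last by ring.
  by rewrite ler_wpM2l// mulr_ge0 ?exprn_ge0// opprK addr_ge0.
have c1 : g x - g x0 * normed (k + i * k) x @[i --> \oo] --> g x - g x0 * h x.
  apply: cvgB; first exact: cvg_cst.
  apply: cvgMr.
  apply: (cvg_comp (fun i => (k + i * k)%N) (normed ^~ x) _ (hcvg Jx)).
  apply/cvgnyPge => N; exists N => // i /= Ni.
  by rewrite (leq_trans Ni)// (leq_trans _ (leq_addl _ _))// leq_pmulr.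
have c2 : 2 * A * A' * h x * delta ^+ i - `|g x - g x0 * normed (k + i * k) x|
    @[i --> \oo] --> 2 * A * A' * h x * 0 - `|g x - g x0 * h x|.
  by apply: cvgB; [apply: cvgMr; exact: cvg_delta|exact: cvg_norm].
have : 0 <= 2 * A * A' * h x * 0 - `|g x - g x0 * h x|.
  by apply: (cvgn_ge c2) => i; rewrite subr_ge0.
by rewrite mulr0 add0r oppr_ge0 normr_le0 subr_eq0 => /eqP.
Qed.
End eigen.
End Doeblin.

(** * The transition operator and the survival probabilities *)
Section Operator.
Context {R : realType}.
Local Notation leb := (@lebesgue_measure R).
Implicit Types (f g h : R -> R) (p x y : R).

(** [s = true] is nondecreasing and [s = false] nonincreasing on [[b, 1]]; the
    operator below is of the type [s = (theta < 0)]. *)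
Definition mono (b : R) (s : bool) f := forall x y, x \in `[b, 1] -> y \in `[b, 1] ->
  x <= y -> if s then f x <= f y else f y <= f x.

Lemma mono_on_int b s f : b <= 1 -> mono b s f -> on_int b f.
Proof.
move=> b1 fm; apply: measurable_bounded_integrable => //=.
- by rewrite lebesgue_measure_itv/=; case: ifP => _; rewrite ?ltry// -EFinB ltry.
- have cJ x : clamp b x \in `[b, 1] by rewrite in_itv/= clamp_itv.
  apply: (eq_measurable_fun (f \o clamp b)) => [x|]; rewrite ?inE/=.
    by rewrite in_itv/= => xJ; rewrite clamp_id.
  case: s fm => fm; [apply: nondecreasing_measurable|apply: nonincreasing_measurable] => // x y xy;
    by apply: fm => //; exact: clamp_homo.
- have bJ : b \in `[b, 1] by rewrite in_itv/= lexx.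
  have J1 : 1 \in `[b, 1] by rewrite in_itv/= lexx b1.
  exists (Num.max `|f b| `|f 1|); split; first exact: num_real.
  move=> M hM x /= xJ; apply/ltW; apply: le_lt_trans hM.
  have := fm b x bJ xJ; have := fm x 1 xJ J1.
  move: xJ; rewrite in_itv/= => /andP[bx x1] /(_ x1) h1 /(_ bx) h2.
  rewrite le_max.
  have := ler_norm (f b); have := ler_norm (- f b); have := ler_norm (f 1).
  have := ler_norm (- f 1); rewrite !normrN => q1 q2 q3 q4.
  rewrite !ler_norml.
  case: s {fm} h1 h2 => h1 h2; have [f0|f0] := lerP 0 (f x); apply/orP.
  - right; apply/andP; split; lra.
  - left; apply/andP; split; lra.
  - left; apply/andP; split; lra.
  - right; apply/andP; split; lra.
Qed.

Lemma tail_int_cvg b (F : nat -> R -> R) f B p : (forall n, on_int b (F n)) ->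
  (forall x, x \in `[b, 1] -> F ^~ x @ \oo --> f x) ->
  (forall n x, x \in `[b, 1] -> `|F n x| <= B) ->
  tail_int b (F n) p @[n --> \oo] --> tail_int b f p.
Proof.
move=> Fi Ff FB; have mt := measurable_tail b p.
have Bi : leb.-integrable (tail b p) (EFin \o cst B).
  by apply: on_int_tail; exact: on_int_cst.
have key : (\int[leb]_(x in tail b p) (EFin \o F n) x @[n --> \oo] -->
            \int[leb]_(x in tail b p) (EFin \o f) x)%E.
  apply: (@dominated_cvg _ _ _ leb _ mt _ _ (EFin \o cst B)) => //.
  - by move=> n; have /integrableP[] := on_int_tail p (Fi n).
  - by move=> x [_ xJ]; apply: cvg_EFin; [exact: nearW|exact: Ff].
  - by move=> n x [_ xJ]; rewrite /= lee_fin; exact: FB.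
have fB x : x \in `[b, 1] -> `|f x| <= B.
  move=> xJ; have c : `|F n x| @[n --> \oo] --> `|f x| by apply: cvg_norm; exact: Ff.
  by apply: (@cvgn_le _ (fun n => `|F n x|) _ _ c) => n; exact: FB.
have mF n : measurable_fun (tail b p) (EFin \o F n).
  by have /integrableP[] := on_int_tail p (Fi n).
have mf : measurable_fun (tail b p) (EFin \o f).
  apply: (emeasurable_fun_cvg (fun n => EFin \o F n)) => // x [_ xJ].
  by apply: cvg_EFin; [exact: nearW|exact: Ff].
have fi : leb.-integrable (tail b p) (EFin \o f).
  apply: le_integrable Bi => // x [_ xJ] /=; rewrite lee_fin.
  by rewrite (le_trans (fB x xJ))// ler_norm.
have ffin := @integrable_fin_num _ _ _ leb _ mt _ fi.
by rewrite -(fineK ffin) in key; move/fine_cvgP : key => [].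
Qed.

Variables (theta b c : R).
Hypotheses (b1 : b < 1) (c0 : 0 < c).
Let bJ : b \in `[b, 1]. Proof. by rewrite in_itv/= lexx ltW. Qed.
Let J1 : 1 \in `[b, 1]. Proof. by rewrite in_itv/= lexx ltW. Qed.

Definition Kop f x := c * tail_int b f (theta * x).

Lemma eq_Kop f g x : (forall y, y \in `[b, 1] -> f y = g y) -> Kop f x = Kop g x.
Proof. by move=> fg; rewrite /Kop (eq_tail_int _ fg). Qed.

Lemma Kop_lin f g r s x : on_int b f -> on_int b g ->
  Kop (fun y => r * f y + s * g y) x = r * Kop f x + s * Kop g x.
Proof. by move=> fi gi; rewrite /Kop tail_int_lin//; ring. Qed.

Lemma Kop_ge0 f x : (forall y, y \in `[b, 1] -> 0 <= f y) -> 0 <= Kop f x.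
Proof. by move=> f0; rewrite mulr_ge0 ?(ltW c0)// tail_int_ge0. Qed.

Lemma Kop_mono f : on_int b f -> (forall y, y \in `[b, 1] -> 0 <= f y) ->
  forall x y, x <= y -> if theta < 0 then Kop f x <= Kop f y else Kop f y <= Kop f x.
Proof.
move=> fi f0 x y xy; case: ifPn => [t0|]; last rewrite -leNgt => t0.
  by rewrite ler_wpM2l ?(ltW c0)//; apply: tail_int_anti => //; [exact: ltW|rewrite ler_wnM2l// ltW].
by rewrite ler_wpM2l ?(ltW c0)//; apply: tail_int_anti => //; [exact: ltW|rewrite ler_wpM2l].
Qed.

Definition chain (phi : nat -> R -> R) := forall n, on_int b (phi n) /\
  forall x, x \in `[b, 1] -> phi n.+1 x = Kop (phi n) x.

Lemma on_int_lin f g r s : on_int b f -> on_int b g ->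
  on_int b (fun y => r * f y + s * g y).
Proof.
move=> fi gi.
have Zint (k : R) u : on_int b u -> on_int b (fun y => k * u y).
  move=> ui; have m : measurable (`[b, 1]%classic : set R) by [].
  have := @integrableZl _ _ _ leb _ m k _ ui; congr (_.-integrable _ _).
have := integrableD _ (Zint r f fi) (Zint s g gi).
by move/(_ (measurable_itv _)); congr (_.-integrable _ _).
Qed.

Lemma chainL phi psi r s : chain phi -> chain psi ->
  chain (fun n x => r * phi n x + s * psi n x).
Proof.
move=> Cp Cq n; have [i1 e1] := Cp n; have [i2 e2] := Cq n; split.
  exact: on_int_lin.
by move=> x xJ; rewrite e1// e2// Kop_lin.
Qed.

Lemma chainS n phi : chain phi -> chain (shift n phi).
Proof. by move=> Cp i; rewrite /shift addSn; exact: Cp. Qed.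

Lemma chain_ge0 phi : chain phi -> (forall x, x \in `[b, 1] -> 0 <= phi 0%N x) ->
  forall n x, x \in `[b, 1] -> 0 <= phi n x.
Proof.
move=> Cp p0; elim=> // n IH x xJ; have [_ ->//] := Cp n.
exact: Kop_ge0.
Qed.

Lemma chain_mono phi n : chain phi -> (forall x, x \in `[b, 1] -> 0 <= phi n x) ->
  mono b (theta < 0) (phi n.+1).
Proof.
move=> Cp p0 x y xJ yJ xy; have [i e] := Cp n; rewrite !e//.
exact: Kop_mono.
Qed.

(** [surv n x] is the probability of [n] allowed steps from [x].  It is cut off
    outside [[b, 1]] so that it can be integrated against the law on the line. *)
Fixpoint surv n x : R :=
  if x \in `[b, 1] then (if n is m.+1 then Kop (surv m) x else 1) else 0.

Lemma surv_ge0 n x : 0 <= surv n x.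
Proof.
elim: n x => [|n IH] x /=; case: ifP => // xJ.
by apply: Kop_ge0.
Qed.

Lemma surv_mono n : mono b (theta < 0) (surv n).
Proof.
elim: n => [|n IH] x y xJ yJ xy /=; rewrite xJ yJ; first by case: ifP.
apply: Kop_mono => //; first by apply: mono_on_int IH; exact: ltW.
by move=> z _; exact: surv_ge0.
Qed.

Lemma surv_chain : chain surv.
Proof.
move=> n; split; last by move=> x xJ /=; rewrite xJ.
by apply: mono_on_int (surv_mono n); exact: ltW.
Qed.

End Operator.

(** * The Doeblin condition for the operator *)
Section Reference.
Context {R : realType}.
Variables (theta b c : R).
Hypotheses (b1 : b < 1) (c0 : 0 < c) (theta1 : theta < 1).
Local Notation J := (fun x : R => is_true (x \in `[b, 1])).
Local Notation surv := (surv theta b c).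
Local Notation chain := (chain theta b c).
Let bJ : b \in `[b, 1]. Proof. by rewrite in_itv/= lexx ltW. Qed.
Let J1 : 1 \in `[b, 1]. Proof. by rewrite in_itv/= lexx ltW. Qed.
Let b1' : b <= 1 := ltW b1.
Let c0' : 0 <= c := ltW c0.

Let si n : on_int b (surv n).
Proof. exact: (surv_chain theta b1 c0 n).1. Qed.
Let s0 n y : y \in `[b, 1] -> 0 <= surv n y.
Proof. by move=> _; exact: surv_ge0. Qed.
Let sS n x : x \in `[b, 1] -> surv n.+1 x = c * tail_int b (surv n) (theta * x).
Proof. exact: (surv_chain theta b1 c0 n).2. Qed.

(** From a point above [safe] all successors above [safe] are allowed, whatever the
    sign of [theta]; this yields the lower bounds on the survival probabilities. *)
Definition safe := Num.max (Num.max 0 theta) b.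

Lemma safe_lt1 : safe < 1. Proof. by rewrite /safe !gt_max ltr01 theta1 b1. Qed.
Lemma safe_ge0 : 0 <= safe. Proof. by rewrite /safe !le_max lexx. Qed.
Lemma safe_geb : b <= safe. Proof. by rewrite /safe !le_max lexx !orbT. Qed.
Lemma safe_theta x : safe <= x -> x <= 1 -> theta * x <= safe.
Proof.
move=> sx x1; have x0 := le_trans safe_ge0 sx.
have [t0|t0] := leP 0 theta.
  rewrite (@le_trans _ _ theta)//; last by rewrite /safe !le_max lexx !orbT.
  by rewrite -[leRHS]mulr1 ler_wpM2l.
by rewrite (le_trans _ safe_ge0)// nmulr_rle0.
Qed.

Lemma safe_J x : safe <= x -> x <= 1 -> x \in `[b, 1].
Proof. by move=> h1 h2; rewrite in_itv/= h2 (le_trans safe_geb). Qed.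

Let surv_mass n p r : 0 <= r -> (forall y, safe <= y -> y <= 1 -> r <= surv n y) ->
  r * (1 - Num.max p safe) <= tail_int b (surv n) p.
Proof.
move=> r0 h; have [p1|p1] := leP 1 p.
  rewrite tail_int1// mulr_ge0_le0// subr_le0 le_max p1//.
have mp : b <= Num.max p safe <= 1.
  by rewrite le_max safe_geb orbT ge_max (ltW p1) (ltW safe_lt1).
apply: (@le_trans _ _ (tail_int b (surv n) (Num.max p safe))); last first.
  by apply: (tail_int_anti b1' (si n) (@s0 n)); rewrite le_max lexx.
have := @tail_int_ge_mass _ b (surv n) (Num.max p safe) 1 r b1' (si n) (@s0 n).
rewrite (clamp_id mp) (@clamp_id _ b 1) ?b1' ?lexx//; apply; first by case/andP: mp.
move=> y _ py y1; apply: h => //; apply: le_trans (ltW py).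
by rewrite le_max lexx orbT.
Qed.

Lemma surv_safe n x : safe <= x -> x <= 1 -> (c * (1 - safe)) ^+ n <= surv n x.
Proof.
elim: n x => [|n IH] x sx x1; first by rewrite /= expr0 safe_J.
rewrite sS ?safe_J// exprS -mulrA ler_wpM2l//.
have q0 : 0 <= (c * (1 - safe)) ^+ n.
  by rewrite exprn_ge0// mulr_ge0// subr_ge0 ltW// safe_lt1.
have := @surv_mass n (theta * x) _ q0 IH.
by rewrite (max_idPr (safe_theta sx x1)) mulrC.
Qed.

Lemma surv_gt0 n x : x \in `[b, 1] -> theta * x < 1 -> 0 < surv n x.
Proof.
move=> xJ tx; case: n => [|n]; first by rewrite /= xJ.
have q0 : 0 < (c * (1 - safe)) ^+ n.
  by rewrite exprn_gt0// mulr_gt0// subr_gt0 safe_lt1.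
rewrite sS// mulr_gt0//.
have := @surv_mass n (theta * x) _ (ltW q0) (@surv_safe n).
apply: lt_le_trans; rewrite mulr_gt0// subr_gt0 gt_max tx safe_lt1//.
Qed.

Lemma surv1_gt0 n : 0 < surv n 1.
Proof. by apply: surv_gt0 => //; rewrite mulr1. Qed.

Definition reference k n0 ell u beta := [/\ (0 < k)%N,
  doeblin J chain k ell u, 1 <= beta,
  (forall n, 0 < ell (shift n (shift n0 surv))) &
  (forall n x, x \in `[b, 1] ->
     shift n0 surv (n + k)%N x <= beta * (u x * ell (shift n (shift n0 surv))))].

Section Negative.
Hypothesis theta0 : theta < 0.

(* [ell] is [c] times the mean of the second term of the orbit and [u x] the length of the
   set of successors of [x]. *)
Let ell (phi : nat -> R -> R) := c / (1 - b) * tail_int b (phi 1%N) b.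
Let u x := 1 - clamp b (theta * x).

Let cb0 : 0 < c / (1 - b). Proof. by rewrite divr_gt0// subr_gt0. Qed.

Lemma doeblin_neg : doeblin J chain 2 ell u.
Proof.
split.
- move=> phi psi r s; exact: chainL.
- move=> n phi; exact: chainS.
- by move=> phi Cp p0 n x; exact: (chain_ge0 c0 Cp).
- by move=> phi psi r s Cp Cq; rewrite /ell tail_int_lin; [ring|case: (Cp 1%N)|case: (Cq 1%N)].
- move=> phi Cp p0; rewrite mulr_ge0 ?(ltW cb0)//; apply: tail_int_ge0 => y yJ.
  exact: (chain_ge0 c0 Cp).
- move=> phi Cp p0 x xJ.
  have [i1 e1] := Cp 1%N; rewrite e1// /Kop /ell /u.
  have m := chain_mono b1 c0 Cp p0; rewrite theta0 in m.
  have := tail_int_chebyshev (theta * x) b1' i1 m.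
  move=> tc; rewrite mulrCA -mulrA ler_wpM2l// ler_pdivrMl ?subr_gt0//.
Qed.

(** The value of [surv (n + 1)] at [1] is at most [c] times the integral of [surv n].
    On [[safe, 1]] it is at least a multiple of that integral, by the inequality for
    upper averages, because all of [[safe, 1]] can be reached from there.  Hence it
    is at most a multiple of the mean of [surv (n + 1)]. *)
Lemma up_neg n x : x \in `[b, 1] ->
  surv (n + 2)%N x <= (1 - b) ^+ 2 / (1 - safe) ^+ 2 * (u x * ell (shift n surv)).
Proof.
move=> xJ; rewrite addn2 sS//.
have m k : forall x y, x \in `[b, 1] -> y \in `[b, 1] -> x <= y -> surv k x <= surv k y.
  by have := surv_mono theta b1 c0 k; rewrite theta0.
have h1 : tail_int b (surv n.+1) (theta * x) <= surv n.+1 1 * u x.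
  apply: tail_int_le_mass => // y yJ; apply: m => //.
  by move: yJ; rewrite in_itv/= => /andP[].
have h2 : surv n.+1 1 <= c * tail_int b (surv n) b.
  rewrite sS// ler_wpM2l// (tail_int_clamp _ b1')//.
  by apply: (tail_int_anti b1' (si n) (@s0 n)); have /andP[] := clamp_itv (theta * 1) b1'.
have cs : clamp b safe = safe by rewrite clamp_id// safe_geb ltW// safe_lt1.
have s1 : 0 < 1 - safe by rewrite subr_gt0 safe_lt1.
have sJ : safe \in `[b, 1] by apply: safe_J => //; rewrite ltW// safe_lt1.
have h3 : c * ((1 - safe) * tail_int b (surv n) b) <= (1 - b) * surv n.+1 safe.
  have := @tail_int_chebyshev _ b (surv n) safe b1' (si n) (m n); rewrite cs => h.
  rewrite sS// [leRHS]mulrCA ler_wpM2l//; apply: le_trans h _.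
  rewrite ler_wpM2l ?subr_ge0//; apply: (tail_int_anti b1' (si n) (@s0 n)).
  by apply: safe_theta => //; rewrite ltW// safe_lt1.
have h4 : surv n.+1 safe * (1 - safe) <= tail_int b (surv n.+1) b.
  apply: (@le_trans _ _ (tail_int b (surv n.+1) safe)); last first.
    by apply: (tail_int_anti b1' (si _) (@s0 _)); exact: safe_geb.
  have := @tail_int_ge_mass _ b (surv n.+1) safe 1 (surv n.+1 safe) b1' (si _) (@s0 _).
  rewrite cs (@clamp_id _ b 1) ?b1' ?lexx//; apply; first by rewrite ltW// safe_lt1.
  by move=> y yJ sy _; apply: m => //; exact: ltW.
have u0 : 0 <= u x by rewrite subr_ge0; have /andP[] := clamp_itv (theta * x) b1'.
apply: (@le_trans _ _ (c * (surv n.+1 1 * u x))); first by rewrite ler_wpM2l.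
rewrite /ell /shift add1n.
rewrite [leRHS](_ : _ = c * ((1 - b) * tail_int b (surv n.+1) b / (1 - safe) ^+ 2 * u x)); last first.
  by field; rewrite !gt_eqF ?subr_gt0 ?safe_lt1.
rewrite ler_wpM2l// ler_wpM2r// ler_pdivlMr ?exprn_gt0//.
have b0 : 0 <= 1 - b by rewrite subr_ge0.
apply: (@le_trans _ _ (c * tail_int b (surv n) b * (1 - safe) ^+ 2)).
  by rewrite ler_wpM2r// exprn_ge0// ltW.
apply: (@le_trans _ _ ((1 - b) * surv n.+1 safe * (1 - safe))).
  by rewrite expr2 mulrA ler_wpM2r ?(ltW s1)// -mulrA [_ * (1 - safe)]mulrC.
by rewrite -mulrA ler_wpM2l.
Qed.

Lemma reference_neg : exists k n0 ell u beta, reference k n0 ell u beta.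
Proof.
exists 2%N, 0%N, ell, u, (Num.max 1 ((1 - b) ^+ 2 / (1 - safe) ^+ 2)).
have s0E : shift 0 surv = surv by apply/funext => i; rewrite /shift addn0.
have ell0 n : 0 < ell (shift n surv).
  rewrite /ell mulr_gt0//.
  have q0 : 0 < (c * (1 - safe)) ^+ (1 + n).
    by rewrite exprn_gt0// mulr_gt0// subr_gt0 safe_lt1.
  have := @surv_mass (1 + n) b _ (ltW q0) (@surv_safe (1 + n)).
  by apply: lt_le_trans; rewrite mulr_gt0// subr_gt0 gt_max b1 safe_lt1.
rewrite /reference s0E; split => //; [exact: doeblin_neg|by rewrite le_max lexx|].
move=> n x xJ; apply: le_trans (up_neg n xJ) _.
rewrite ler_wpM2r ?le_max ?lexx ?orbT//.
rewrite mulr_ge0 ?(ltW (ell0 n))//.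
by rewrite subr_ge0; have /andP[] := clamp_itv (theta * x) b1'.
Qed.

End Negative.

Section Nonnegative.
Hypotheses (theta0 : 0 <= theta) (b0 : 0 <= b).

Let m k x y : x \in `[b, 1] -> y \in `[b, 1] -> x <= y -> surv k y <= surv k x.
Proof. by have := surv_mono theta b1 c0 k; rewrite ltNge theta0/=; exact. Qed.

Let sig x := clamp b (theta * x).

Lemma sig_bounds x : x \in `[b, 1] -> b <= sig x /\ sig x - b <= theta * (x - b) /\ sig x < 1.
Proof.
rewrite in_itv/= => /andP[bx x1].
have tx : theta * x <= theta by rewrite -[leRHS]mulr1 ler_wpM2l.
have x0 := le_trans b0 bx.
rewrite /sig; have /andP[-> _] := clamp_itv (theta * x) b1'; split => //.
have [tb|bt] := leP (theta * x) b.
  rewrite /clamp (max_idPl tb) (min_idPr b1') subrr; split=> //.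
  by rewrite mulr_ge0// subr_ge0.
rewrite clamp_id; last by rewrite (ltW bt)/= (le_trans tx)// ltW.
split; last exact: le_lt_trans theta1.
by rewrite mulrBr lerD2l lerN2 -[leRHS]mul1r ler_wpM2r// ltW.
Qed.

(** From [x] one can descend in [k] steps to within [e] of the point
    [b + theta ^+ k * (x - b)], with a probability that is bounded below; each step
    loses the factor [eta], the length of the interval of landing points. *)
Lemma surv_reach k e x : 0 < e -> x \in `[b, 1] -> exists2 del : R, 0 < del &
  forall n, del * surv n (Num.min 1 (b + theta ^+ k * (x - b) + e)) <= surv (n + k)%N x.
Proof.
elim: k e x => [|k IH] e x e0 xJ.
  exists 1 => // n; rewrite mul1r addn0 expr0 mul1r.
  move: (xJ); rewrite in_itv/= => /andP[bx x1].
  apply: m => //; last by rewrite le_min x1/=; lra.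
  by rewrite in_itv/= ge_min lexx/= andbT le_min b1'/=; lra.
have [bs [sb s1]] := sig_bounds xJ.
pose eta := Num.min (e / 2) (1 - sig x).
have eta0 : 0 < eta by rewrite lt_min divr_gt0//= subr_gt0.
have etae : eta <= e / 2 by rewrite ge_min lexx.
have etas : eta <= 1 - sig x by rewrite ge_min lexx orbT.
have x'J : sig x + eta \in `[b, 1] by rewrite in_itv/=; lra.
have [del del0 hdel] := IH (e / 2) (sig x + eta) (divr_gt0 e0 (ltr0Sn _ _)) x'J.
exists (c * (eta * del)) => [|n]; first by rewrite !mulr_gt0.
rewrite addnS sS// -mulrA ler_wpM2l// (tail_int_clamp _ b1')// -/(sig x).
apply: (@le_trans _ _ (eta * surv (n + k)%N (sig x + eta))); last first.
  have := @tail_int_ge_mass _ b (surv (n + k)) (sig x) (sig x + eta)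
    (surv (n + k) (sig x + eta)) b1' (si _) (@s0 _).
  rewrite (@clamp_id _ b (sig x)) ?bs ?(ltW s1)//.
  rewrite (@clamp_id _ b (sig x + eta)); last by move: x'J; rewrite in_itv.
  rewrite addrAC subrr add0r mulrC; apply; first by rewrite lerDl ltW.
  by move=> y yJ _ ys; exact: m.
rewrite -mulrA ler_wpM2l ?(ltW eta0)//; apply: le_trans (hdel n).
have tk0 : 0 <= theta ^+ k by exact: exprn_ge0.
have tk1 : theta ^+ k <= 1 by rewrite exprn_ile1// ltW.
have xb : 0 <= x - b by move: xJ; rewrite in_itv/= subr_ge0 => /andP[].
have hmin r : 0 <= r -> Num.min 1 (b + r) \in `[b, 1].
  by move=> r0; rewrite in_itv/= ge_min lexx/= andbT le_min b1'/= lerDl.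
rewrite ler_wpM2l ?(ltW del0)//; apply: m.
- by rewrite -addrA hmin// addr_ge0 ?mulr_ge0 ?(ltW (divr_gt0 _ _))//; lra.
- by rewrite -addrA hmin// addr_ge0 ?(ltW e0)// mulr_ge0// exprn_ge0.
rewrite le_min !ge_min lexx/= -!addrA lerD2l.
have : theta ^+ k * (sig x + eta - b) <= theta ^+ k * (theta * (x - b)) + e / 2.
  have : theta ^+ k * (sig x + eta - b) <= theta ^+ k * (theta * (x - b) + e / 2).
    by rewrite ler_wpM2l//; lra.
  move/le_trans; apply; rewrite mulrDr lerD2l ger_pMl//; lra.
rewrite exprS [theta * _]mulrC -mulrA; lra.
Qed.

(** Write [a n] and [d n] for the values of [surv n] at [b] and [1].  Then
    [d (n + 1) >= q (d n)] and [a (n + 1) <= (q / 2) (a n) + C d (n + k)], the first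
    term being the contribution of [[b, b + e]] and the second one that of
    the rest, by [surv_reach].  As the first term grows at a rate of at most [q / 2] and
    [d] at a rate of at least [q], induction gives [a n <= A d (n + k)]; finally
    [k] steps increase [a] by a bounded factor only. *)
Lemma harnack_pos : exists n0 (A : R), 0 < A /\
  forall n, surv (n + n0)%N b <= A * surv (n + n0)%N 1.
Proof.
(* [w] is the length of the set of successors of [1]. *)
pose w := 1 - Num.max theta b; pose q := c * w; pose e := w / 2.
have w0 : 0 < w by rewrite subr_gt0 gt_max theta1 b1.
have q0 : 0 < q by rewrite mulr_gt0.
have e0 : 0 < e by rewrite divr_gt0.
have wb : w <= 1 - b by rewrite lerD2l lerN2 le_max lexx orbT.
have beJ : b + e \in `[b, 1] by rewrite in_itv/= /e; lra.
have [k hk] : exists k : nat, theta ^+ k * (1 - b) <= e / 2.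
  have cv : theta ^+ k * (1 - b) @[k --> \oo] --> 0 * (1 - b).
    by apply: cvgMl; apply: cvg_expr; rewrite ger0_norm.
  have e20 : 0 < e / 2 by rewrite divr_gt0.
  rewrite mul0r in cv; have := cvgr_le _ cv _ e20.
  by case=> N _ /(_ N (leqnn N)) /= ?; exists N.
have [del del0 hdel] := @surv_reach k (e / 2) 1 (divr_gt0 e0 (ltr0Sn _ _)) J1.
pose a n := surv n b; pose d n := surv n 1.
have d0 n : 0 < d n by exact: surv1_gt0.
have dS n : q * d n <= d n.+1.
  rewrite /d sS// /q -mulrA ler_wpM2l// mulr1.
  have := @tail_int_ge_mass _ b (surv n) theta 1 (surv n 1) b1' (si _) (@s0 _) (ltW theta1).
  have -> : clamp b theta = Num.max theta b.
    by rewrite /clamp (min_idPr _) 1?maxC// ge_max b1' ltW.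
  rewrite (@clamp_id _ b 1) ?b1' ?lexx// mulrC; apply.
  by move=> y yJ _ y1; exact: m.
have reach n : surv n (b + e) <= d (n + k)%N / del.
  rewrite ler_pdivlMr// mulrC; apply: le_trans (hdel n); rewrite ler_wpM2l ?(ltW del0)//.
  apply: m => //; last by rewrite ge_min -addrA lerD2l; apply/orP; right; lra.
  rewrite in_itv/= ge_min lexx/= andbT le_min b1'/= -addrA lerDl addr_ge0//.
    by rewrite mulr_ge0 ?subr_ge0// exprn_ge0.
  by rewrite ltW// divr_gt0.
have clb : clamp b (theta * b) = b.
  rewrite /clamp (max_idPl _) ?(min_idPr b1')//.
  by rewrite -[leRHS]mul1r ler_wpM2r// ltW.
have cb : clamp b b = b by rewrite clamp_id// lexx b1'.
have aS n : a n.+1 <= q / 2 * a n + c * (1 - b) / del * d (n + k)%N.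
  rewrite /a sS// (tail_int_clamp _ b1')// clb.
  have be1 : b + e <= 1 by move: beJ; rewrite in_itv/= => /andP[].
  have beb : b <= b + e by rewrite lerDl ltW.
  have cbe : clamp b (b + e) = b + e by rewrite clamp_id// beb be1.
  have h1 : tail_int b (surv n) b - tail_int b (surv n) (b + e) <= surv n b * e.
    have := @tail_int_bounds _ b (surv n) b (b + e) 0 (surv n b) b1' (si _) beb.
    rewrite cb cbe => /(_ _)/andP[|_]; last by rewrite addrAC subrr add0r.
    move=> y yJ by_ _; rewrite surv_ge0//= m//; exact: ltW.
  have h2 : tail_int b (surv n) (b + e) <= surv n (b + e) * (1 - b).
    have := @tail_int_bounds _ b (surv n) (b + e) 1 0 (surv n (b + e)) b1' (si _) be1.
    rewrite cbe (@clamp_id _ b 1) ?b1' ?lexx// (tail_int1 b _ (lexx 1)) subr0.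
    move=> /(_ _)/andP[|_ /le_trans]; last first.
      by apply; rewrite ler_wpM2l ?surv_ge0// lerD2l lerN2.
    by move=> y yJ by_ _; rewrite surv_ge0//= m//; exact: ltW.
  have h3 := reach n.
  rewrite (_ : q / 2 * _ + _ = c * (surv n b * e + d (n + k)%N / del * (1 - b))); last first.
    by rewrite /q /e; field; rewrite gt_eqF.
  rewrite ler_wpM2l//.
  have : surv n (b + e) * (1 - b) <= d (n + k)%N / del * (1 - b).
    by rewrite ler_wpM2r// subr_ge0.
  lra.
pose A := Num.max (a 0%N / d k) (2 * (c * (1 - b) / del) / q).
have A1 : a 0%N <= A * d k by rewrite -ler_pdivrMr// le_max lexx.
have A2 : c * (1 - b) / del <= A * q / 2.
  by rewrite ler_pdivlMr// mulrC -ler_pdivrMr// le_max lexx orbT.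
have main n : a n <= A * d (n + k)%N.
  elim: n => [|n IH]; first by rewrite add0n.
  apply: le_trans (aS n) _; rewrite addSn.
  have A0 : 0 <= A by rewrite le_max divr_ge0// ?surv_ge0.
  have h1 : q / 2 * a n <= q / 2 * (A * d (n + k)%N).
    by rewrite ler_wpM2l// ltW// divr_gt0.
  have h2 : c * (1 - b) / del * d (n + k)%N <= A * q / 2 * d (n + k)%N.
    by rewrite ler_wpM2r// ltW.
  have h3 : A * (q * d (n + k)%N) <= A * d (n + k).+1 by rewrite ler_wpM2l.
  lra.
have cb0 : 0 <= c * (1 - b) by rewrite mulr_ge0// subr_ge0.
have grow n j : a (n + j)%N <= (c * (1 - b)) ^+ j * a n.
  elim: j => [|j IH]; first by rewrite addn0 expr0 mul1r.
  rewrite addnS exprS -mulrA; apply: (@le_trans _ _ (c * (1 - b) * a (n + j)%N)); last first.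
    by rewrite ler_wpM2l.
  rewrite /a sS// (tail_int_clamp _ b1')// clb -mulrA ler_wpM2l//.
  have := @tail_int_le_mass _ b (surv (n + j)) b (a (n + j)%N) b1' (si _).
  rewrite cb mulrC; apply => y yJ; apply: m => //.
  by move: yJ; rewrite in_itv/= => /andP[].
exists k, ((c * (1 - b)) ^+ k * A + 1); split.
  by rewrite ltr_wpDl// mulr_ge0 ?exprn_ge0// le_max divr_ge0// ?surv_ge0.
move=> n; apply: le_trans (grow n k) _.
apply: (@le_trans _ _ ((c * (1 - b)) ^+ k * (A * d (n + k)%N))).
  by rewrite ler_wpM2l// exprn_ge0.
by rewrite [leRHS]mulrDl mul1r -mulrA lerDl; exact: ltW (d0 _).
Qed.

Lemma reference_pos : exists k n0 ell u beta, reference k n0 ell u beta.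
Proof.
have [n0 [A [A0 hA]]] := harnack_pos.
exists 1%N, n0, (fun phi => phi 1%N 1), (fun=> 1), (Num.max 1 A).
have leb1 x : x \in `[b, 1] -> x <= 1 by rewrite in_itv/= => /andP[].
have lebx x : x \in `[b, 1] -> b <= x by rewrite in_itv/= => /andP[].
split => //.
- split.
  + by move=> phi psi r s; exact: chainL.
  + by move=> n phi; exact: chainS.
  + by move=> phi Cp p0 n x; exact: (chain_ge0 c0 Cp).
  + by [].
  + by move=> phi Cp p0; exact: (chain_ge0 c0 Cp).
  + move=> phi Cp p0 x xJ; rewrite mul1r.
    have := chain_mono b1 c0 Cp p0; rewrite ltNge theta0/= => /(_ x 1 xJ J1); apply.
    exact: leb1.
- by rewrite le_max lexx.
- by move=> n; exact: surv1_gt0.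
move=> n x xJ; rewrite mul1r /shift addn1 add1n addSn.
apply: (@le_trans _ _ (surv (n + n0).+1 b)); first by apply: m => //; exact: lebx.
have := hA n.+1; rewrite addSn => /le_trans; apply.
by rewrite ler_wpM2r ?surv_ge0// le_max lexx orbT.
Qed.

End Nonnegative.
End Reference.

(** * The principal eigenvalue and its eigenfunction *)

(** The eigenfunction is determined on the whole line by its values on [[b, 1]]
    and is normalized at [1], where all [surv n] are positive. *)
Record perron_pair {R : realType} (theta b c lambda : R) (h : R -> R) : Prop := {
  pp_lambda : 0 < lambda;
  pp_eigen : forall x, lambda * h x = Kop theta b c h x;
  pp_mono : mono b (theta < 0) h;
  pp_ge0 : forall x, x \in `[b, 1] -> 0 <= h x;
  pp_gt0 : forall x, x \in `[b, 1] -> theta * x < 1 -> 0 < h x;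
  pp_h1 : h 1 = 1;
  pp_cvg : forall x, x \in `[b, 1] ->
    surv theta b c n x / surv theta b c n 1 @[n --> \oo] --> h x;
  pp_bound : exists B N, 0 <= B /\ forall n x, (N <= n)%N -> x \in `[b, 1] ->
    surv theta b c n x / surv theta b c n 1 <= B;
  pp_rate : surv theta b c n.+1 1 / surv theta b c n 1 @[n --> \oo] --> lambda;
  pp_other : forall mu g, on_int b g ->
    (forall x, x \in `[b, 1] -> mu * g x = Kop theta b c g x) ->
    lambda < mu -> forall x, x \in `[b, 1] -> g x = 0;
  pp_unique : forall g, on_int b g ->
    (forall x, x \in `[b, 1] -> lambda * g x = Kop theta b c g x) ->
    forall x, x \in `[b, 1] -> g x = g 1 * h x }.

Section Perron.
Context {R : realType}.
Local Notation leb := (@lebesgue_measure R).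
Variables (theta b c : R).
Hypotheses (b1 : b < 1) (c0 : 0 < c) (theta1 : theta < 1).
Hypothesis sgn : theta < 0 \/ 0 <= b.
Local Notation J := (fun x : R => is_true (x \in `[b, 1])).
Local Notation surv := (surv theta b c).
Local Notation chain := (chain theta b c).
Local Notation Kop := (Kop theta b c).
Let J1 : 1 \in `[b, 1]. Proof. by rewrite in_itv/= lexx ltW. Qed.
Let b1' : b <= 1 := ltW b1.

Lemma reference_exists : exists k n0 ell u beta, reference theta b c k n0 ell u beta.
Proof.
have [t0|t0] := ltP theta 0; first exact: reference_neg.
by case: sgn => [|b0]; [rewrite ltNge t0|exact: reference_pos].
Qed.

Lemma eigen_chain mu g : on_int b g ->
  (forall x, x \in `[b, 1] -> mu * g x = Kop g x) -> chain (fun n x => mu ^+ n * g x).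
Proof.
move=> gi ge n.
have E (r : R) : (fun x => r * g x) = (fun x => r * g x + 0 * g x).
  by apply/funext => x; rewrite mul0r addr0.
split; first by rewrite E; exact: on_int_lin.
move=> x xJ; rewrite E Kop_lin// mul0r addr0 -ge// exprS; ring.
Qed.

Lemma eigen_bounded mu g : 0 < mu -> on_int b g ->
  (forall x, x \in `[b, 1] -> mu * g x = Kop g x) ->
  exists2 B : R, 0 <= B & forall x, x \in `[b, 1] -> `|g x| <= B.
Proof.
move=> mu0 gi ge.
have ai : on_int b (fun x => `|g x|).
  have mJ : measurable (`[b, 1]%classic : set R) by [].
  have := @integrable_norm _ _ _ leb _ _ gi; exact.
have a0 y : y \in `[b, 1] -> 0 <= `|g y| by move=> _; exact: normr_ge0.
exists (c * tail_int b (fun x => `|g x|) (b - `|theta|) / mu).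
  by rewrite divr_ge0 ?(ltW mu0)// mulr_ge0 ?(ltW c0)//; exact: tail_int_ge0.
move=> x xJ; rewrite ler_pdivlMr// -[X in _ * X]gtr0_norm// -normrM mulrC ge//.
rewrite /Kop normrM gtr0_norm// ler_wpM2l ?(ltW c0)//.
apply: (@le_trans _ _ (tail_int b (fun x => `|g x|) (theta * x))).
  by apply: le_normr_Rintegral; [exact: measurable_tail|exact: on_int_tail].
rewrite (tail_int_clamp _ b1' ai).
rewrite [leRHS](_ : _ = tail_int b (fun x => `|g x|) b).
  apply: tail_int_anti => //; by have /andP[] := clamp_itv (theta * x) b1'.
rewrite (tail_int_clamp _ b1' ai); congr (tail_int _ _ _); rewrite /clamp (max_idPl _) ?(min_idPr _)//.
by rewrite gerBl.
Qed.

(** An integrable eigenfunction is bounded, since the operator maps integrable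
    functions to bounded ones; being bounded by a multiple of [surv 0] is preserved
    along orbits. *)
Lemma eigen_le_surv mu g n : 0 < mu -> on_int b g ->
  (forall x, x \in `[b, 1] -> mu * g x = Kop g x) ->
  exists2 A : R, 0 <= A & forall x, x \in `[b, 1] -> `|g x| <= A * surv n x.
Proof.
move=> mu0 gi ge; have [B B0 hB] := eigen_bounded mu0 gi ge.
have Cg := eigen_chain gi ge; have Cs := surv_chain theta b1 c0.
have mun : 0 < mu ^+ n by exact: exprn_gt0.
exists (B / mu ^+ n) => [|x xJ]; first by rewrite divr_ge0// ltW.
have C1 := chainL B 1 Cs Cg; have C2 := chainL B (-1) Cs Cg.
rewrite mulrAC ler_pdivlMr// -[X in _ * X]gtr0_norm// -normrM mulrC ler_norml.
have p1 := chain_ge0 c0 C1 _ n xJ; have p2 := chain_ge0 c0 C2 _ n xJ.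
have : forall y, y \in `[b, 1] -> 0 <= B * surv 0 y + 1 * (mu ^+ 0 * g y).
  by move=> y yJ; have := hB y yJ; rewrite /= yJ expr0 ler_norml; lra.
move/p1 => {p1} p1.
have : forall y, y \in `[b, 1] -> 0 <= B * surv 0 y + (-1) * (mu ^+ 0 * g y).
  by move=> y yJ; have := hB y yJ; rewrite /= yJ expr0 ler_norml; lra.
move/p2 => {p2} p2.
by apply/andP; split; lra.
Qed.

Lemma perron : exists lambda h, perron_pair theta b c lambda h.
Proof.
have [k [n0 [ell [u [beta [k0 D beta1 ell0 up]]]]]] := reference_exists.
pose psi := shift n0 surv.
have Cs := surv_chain theta b1 c0.
have Cpsi : chain psi by exact: chainS.
have s0 n x : 0 <= surv n x by exact: surv_ge0.
have s1 n : 0 < surv n 1 by exact: surv1_gt0.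
have psi0 n x : J x -> 0 <= psi n x by move=> _; exact: s0.
have psi1 n : 0 < psi n 1 by exact: s1.
pose e := normed psi 1.
have ecvg x : J x -> cvgn (e ^~ x).
  exact: (normed_is_cvg D Cpsi psi0 ell0 beta1 up J1 psi1).
have ebd := normed_bounds D Cpsi psi0 ell0 beta1 up J1 psi1.
(* [h0] is the limit on [[b, 1]]; its extension is dictated by the equation. *)
pose h0 x := limn (e ^~ x).
have eh x : J x -> e n x @[n --> \oo] --> h0 x by move=> Jx; exact: ecvg.
have ei n : on_int b (e n).
  rewrite (_ : e n = fun x => (psi n 1)^-1 * psi n x + 0 * psi n x).
    by apply: on_int_lin; exact: (Cpsi n).1.
  by apply/funext => x; rewrite /e /normed mul0r addr0 mulrC.
have eK n x : J x -> e n.+1 x * (psi n.+1 1 / psi n 1) = Kop (e n) x.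
  move=> Jx; have -> : Kop (e n) x = psi n.+1 x / psi n 1.
    rewrite (Cpsi n).2//.
    have -> : e n = fun x => (psi n 1)^-1 * psi n x + 0 * psi n x.
      by apply/funext => y; rewrite /e /normed mul0r addr0 mulrC.
    rewrite Kop_lin; [by rewrite mul0r addr0 mulrC|exact: (Cpsi n).1|exact: (Cpsi n).1].
  by rewrite /e /normed mulrA divfK// gt_eqF.
have h0m : mono b (theta < 0) h0.
  move=> x y xJ yJ xy; have m n := surv_mono theta b1 c0 (n + n0) xJ yJ xy.
  have ex := eh x xJ; have ey := eh y yJ.
  case: ifPn => t0; rewrite -subr_ge0.
    apply: (@cvgn_ge _ (fun n => e n y - e n x)); first exact: cvgB.
    move=> n; rewrite subr_ge0 /e /normed ler_wpM2r ?invr_ge0 ?(ltW (psi1 n))//.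
    by have := m n; rewrite t0.
  apply: (@cvgn_ge _ (fun n => e n x - e n y)); first exact: cvgB.
  move=> n; rewrite subr_ge0 /e /normed ler_wpM2r ?invr_ge0 ?(ltW (psi1 n))//.
  by have := m n; rewrite (negbTE t0).
have h0i : on_int b h0 by exact: mono_on_int h0m.
have e_ge0 n x : J x -> 0 <= e n x.
  by move=> Jx; rewrite divr_ge0 ?psi0// ltW.
have [B B0 hB] : exists2 B, 0 <= B & forall n x, J x -> e (n + k)%N x <= B.
  have bJ : b \in `[b, 1] by rewrite in_itv/= lexx.
  exists (beta ^+ 2 * (e k b + e k 1)).
    by rewrite mulr_ge0 ?exprn_ge0 ?(le_trans _ beta1)// addr_ge0// e_ge0.
  move=> n x Jx; rewrite addnC; have /andP[_ /le_trans] := ebd n x Jx; apply.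
  rewrite ler_wpM2l ?exprn_ge0 ?(le_trans _ beta1)//.
  have m := surv_mono theta b1 c0 (k + n0).
  move: (Jx); rewrite in_itv/= => /andP[bx x1].
  have ekb := e_ge0 k b bJ; have ek1 := e_ge0 k 1 J1.
  have i0 : 0 <= (psi k 1)^-1 by rewrite invr_ge0 ltW.
  have [t0|t0] := boolP (theta < 0).
    rewrite (@le_trans _ _ (e k 1))// ?lerDr// ler_wpM2r//.
    by have := m x 1 Jx J1 x1; rewrite t0.
  rewrite (@le_trans _ _ (e k b))// ?lerDl// ler_wpM2r//.
  by have := m b x bJ Jx bx; rewrite (negbTE t0).
have Kcvg x : Kop (e n) x @[n --> \oo] --> Kop h0 x.
  rewrite -(cvg_shiftn k).
  apply: cvgMr; apply: (@tail_int_cvg _ _ (fun n => e (n + k)%N) _ B) => //.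
  - by move=> y yJ; rewrite (cvg_shiftn k (e ^~ y)); exact: eh.
  - by move=> n y yJ; rewrite ger0_norm ?e_ge0// hB.
pose lambda := Kop h0 1.
have e1 n : e n 1 = 1 by rewrite /e /normed divff// gt_eqF.
have rate : psi n.+1 1 / psi n 1 @[n --> \oo] --> lambda.
  have := Kcvg 1; rewrite (_ : (fun n => Kop (e n) 1) = (fun n => psi n.+1 1 / psi n 1))//.
  by apply/funext => n; rewrite -eK// e1 mul1r.
have h0e x : J x -> h0 x * lambda = Kop h0 x.
  move=> Jx; apply: (@cvg_unique _ (@Rhausdorff R) ((fun n => Kop (e n) x) @ \oo)); last exact: Kcvg.
  rewrite (_ : (fun n => Kop (e n) x) = (fun n => e n.+1 x * (psi n.+1 1 / psi n 1))).
    by apply: cvgM => //; rewrite (cvg_shiftS (e ^~ x)); exact: eh.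
  by apply/funext => n; rewrite eK.
have beta2 : 0 < beta ^+ 2 by rewrite exprn_gt0// (lt_le_trans _ beta1).
have hlow : forall x, J x -> e k x / beta ^+ 2 <= h0 x.
  move=> x Jx; apply: (@cvgn_ge _ (fun n => e (n + k)%N x)).
    by rewrite (cvg_shiftn k (e ^~ x)); exact: eh.
  by move=> n; rewrite addnC; have /andP[] := ebd n x Jx.
have h00 x : J x -> 0 <= h0 x.
  by move=> Jx; apply: le_trans (hlow x Jx); rewrite divr_ge0 ?e_ge0// ltW.
have lambda0 : 0 < lambda.
  have lowi : on_int b (fun x => (beta ^+ 2)^-1 * e k x + 0 * e k x) by exact: on_int_lin.
  apply: (@lt_le_trans _ _ (Kop (fun x => (beta ^+ 2)^-1 * e k x + 0 * e k x) 1)).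
    have Ke : 0 < Kop (e k) 1 by rewrite -eK// e1 mul1r divr_gt0.
    by rewrite Kop_lin// mul0r addr0 mulr_gt0// invr_gt0.
  rewrite /Kop ler_wpM2l ?(ltW c0)//; apply: tail_int_le => // y yJ.
  by rewrite mul0r addr0 mulrC; exact: hlow.
pose h x := lambda^-1 * Kop h0 x.
have hh0 x : J x -> h x = h0 x.
  by move=> Jx; rewrite /h -h0e// mulrC mulfK// gt_eqF.
have hi : on_int b h.
  apply: mono_on_int (_ : mono b (theta < 0) h) => //.
  by move=> x y xJ yJ xy; rewrite !hh0//; exact: h0m.
have heig x : lambda * h x = Kop h x.
  rewrite /h mulrA mulfV ?gt_eqF// mul1r; apply: eq_Kop => y yJ.
  exact/esym/hh0.
have Ch : chain (fun n x => lambda ^+ n * h x) by apply: eigen_chain.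
have ehh x : J x -> e n x @[n --> \oo] --> h x by move=> Jx; rewrite hh0//; exact: eh.
exists lambda, h; split => //.
- by move=> x y xJ yJ xy; rewrite !hh0//; exact: h0m.
- by move=> x xJ; rewrite hh0// h00.
- move=> x xJ tx; rewrite hh0//; apply: lt_le_trans (hlow x xJ).
  by rewrite !divr_gt0//; exact: surv_gt0.
- rewrite hh0//; apply: (@cvg_unique _ (@Rhausdorff R) ((e ^~ 1) @ \oo)); first exact: eh.
  by rewrite (_ : e ^~ 1 = fun=> 1); [exact: cvg_cst|apply/funext => n; rewrite e1].
- by move=> x xJ; rewrite -(cvg_shiftn n0); exact: ehh.
- exists B, (k + n0)%N; split => // n x kn xJ.
  by have := hB (n - (k + n0))%N x xJ; rewrite /e /normed /psi /shift -addnA subnK.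
- by rewrite -(cvg_shiftn n0); exact: rate.
- move=> mu g gi ge lm x xJ; have mu0 := lt_trans lambda0 lm.
  have [A A0 gA] := eigen_le_surv (k + n0) mu0 gi ge.
  exact: (eigen_small D Cpsi psi0 ell0 beta1 up J1 psi1 lambda0 Ch ehh (eigen_chain gi ge) A0 gA lm xJ).
- move=> g gi ge x xJ.
  have [A A0 gA] := eigen_le_surv (k + n0) lambda0 gi ge.
  exact: (eigen_unique D k0 Cpsi psi0 ell0 beta1 up J1 psi1 lambda0 Ch ehh (eigen_chain gi ge) A0 gA xJ).
Qed.

End Perron.

(** * Back to the equation on [[-t, 1]] *)
Section Spectrum.
Context {R : realType}.
Local Notation leb := (@lebesgue_measure R).
Variables (theta a : R).
Hypotheses (theta1 : theta < 1) (a1 : -1 < a).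

(** The left end [b] is chosen so that no allowed step leads from [[b, 1]] to a point
    of [[-a, b[]. *)
Definition left_end : R := if theta < 0 then - a else Num.max 0 (- a).
Definition cutoff : R := if theta < 0 then Num.min a (- theta^-1) else Num.min a 0.
Local Notation b := left_end.
Local Notation t := cutoff.
Local Notation c := (a + 1)^-1.

Lemma left_end_lt1 : b < 1.
Proof. by rewrite /left_end; case: ifP => _; rewrite ?gt_max ?ltr01 ltrNl. Qed.

Lemma left_end_sgn : theta < 0 \/ 0 <= b.
Proof. by rewrite /left_end; case: ifPn => t0; [left|right; rewrite le_max lexx]. Qed.

Lemma left_end_ge : - a <= b.
Proof. by rewrite /left_end; case: ifP => _; rewrite ?le_max lexx ?orbT. Qed.

Lemma width_inv_gt0 : 0 < c. Proof. by rewrite invr_gt0 -ltrBlDr sub0r. Qed.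

Lemma cutoff_cases : t = a \/ (theta != 0 /\ t = - theta^-1) \/ t = 0.
Proof.
rewrite /cutoff; case: ifPn => t0.
  by rewrite /Num.min; case: ifP => _; [left|right; left; rewrite lt_eqF].
by rewrite /Num.min; case: ifP => _; [left|right; right].
Qed.

Lemma left_end_le_cutoff : b <= - t.
Proof.
rewrite /left_end /cutoff; case: ifP => _; first by rewrite lerN2 ge_min lexx.
by rewrite oppr_min oppr0 maxC.
Qed.

(** The points of [[b, 1]] removed by the cutoff have no successor at all. *)
Lemma below_cutoff x : b <= x -> x < - t -> 1 < theta * x.
Proof.
rewrite /left_end /cutoff; case: ifPn => t0 bx.
  rewrite oppr_min lt_max ltNge bx/= opprK => xt.
  by rewrite -(ltr_ndivlMl _ _ t0) mulr1.
by rewrite oppr_min oppr0 maxC ltNge bx.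
Qed.

Lemma state_spaceE x : state_space theta t x <-> x \in `[b, 1] /\ theta * x < 1.
Proof.
have b1 := left_end_lt1; have bt := left_end_le_cutoff.
split.
  move=> []; rewrite /= in_itv/= => /andP[tx x1] hx.
  split; first by rewrite in_itv/= x1 (le_trans bt tx).
  have [t0|t0] := ltP theta 0; last first.
    have [x0|x0] := leP 0 x.
      by apply: le_lt_trans theta1; rewrite -[leRHS]mulr1 ler_wpM2l.
    by rewrite (le_lt_trans _ ltr01)// mulr_ge0_le0// ltW.
  rewrite -(ltr_ndivrMl _ _ t0) mulr1 lt_neqAle.
  have tn0 : theta != 0 by rewrite lt_eqF.
  move: tx hx; rewrite /cutoff t0 /Num.min; case: ifP => [at_|/negbT]; last first.
    by rewrite opprK => _ -> /(_ tn0 erefl) xt; rewrite eq_sym xt.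
  move=> ax _; have {}at_ : theta^-1 < - a by rewrite ltrNr.
  by rewrite (ltW (lt_le_trans at_ ax)) lt_eqF// (lt_le_trans at_ ax).
rewrite in_itv/= => -[/andP[bx x1] tx]; split.
  rewrite /= in_itv/= x1 andbT leNgt; apply/negP => xt.
  by have := below_cutoff bx xt; rewrite ltNge (ltW tx).
move=> tn0 _; apply/eqP => xE; move: tx; rewrite xE mulfV//.
by rewrite ltxx.
Qed.

(** Functions that vanish at the points without successors have the same integral
    over [[-t, 1]] and [[b, 1]]. *)
Lemma statement_integral f x : on_int b f ->
  (forall y, y \in `[b, 1] -> 1 < theta * y -> f y = 0) ->
  \int[leb]_(y in [set y | y > theta * x] `&` `[- t, 1]) (f y * c) = Kop theta b c f x.
Proof.
move=> fi f0.
have fti : leb.-integrable (tail (- t) (theta * x)) (EFin \o f).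
  apply: integrableS fi => //; first exact: measurable_tail.
  move=> y [_] /=; rewrite !in_itv/= => /andP[ty ->]; rewrite andbT.
  exact: le_trans left_end_le_cutoff ty.
rewrite /Kop [RHS]mulrC -/(tail _ _) (@RintegralZr _ _ _ leb _ _ c (measurable_tail _ _) fti).
congr (_ * _); rewrite /tail_int [LHS]Rintegral_mkcond [RHS]Rintegral_mkcond; apply: eq_Rintegral => y _.
rewrite !patchE; case: ifPn => [|].
  rewrite inE => -[/= ty]; rewrite in_itv/= => /andP[tty y1]; rewrite ifT//.
  by rewrite inE; split => //=; rewrite in_itv/= y1 (le_trans left_end_le_cutoff).
move=> yn; case: ifPn => // yin; apply/esym.
move: yin; rewrite inE => -[/= ty yJ]; apply: f0 => //.
move: (yJ); rewrite in_itv/= => /andP[by_ y1]; apply: below_cutoff => //.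
rewrite ltNge; apply/negP => tty; move/negP: yn; apply; rewrite inE; split => //=.
by rewrite in_itv/= tty y1.
Qed.

Lemma eigenfunction_vanish mu g x : mu != 0 -> eigenfunction theta a t mu g ->
  1 <= theta * x -> g x = 0.
Proof.
move=> mu0 [_ _ ge] tx; apply: (mulfI mu0); rewrite mulr0 ge.
rewrite (_ : _ `&` _ = set0) ?Rintegral_set0//.
apply/seteqP; split=> // y [/= ty]; rewrite in_itv/= => /andP[_ y1].
by have := lt_le_trans ty y1; rewrite ltNge tx.
Qed.

Lemma eigenfunction_on_int mu g : mu != 0 -> eigenfunction theta a t mu g -> on_int b g.
Proof.
move=> mu0 ge; have [gi _ _] := ge.
have mJ : measurable (`[b, 1]%classic : set R) by [].
have mt : measurable (`[- t, 1]%classic : set R) by [].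
have : leb.-integrable `[b, 1] ((EFin \o g) \_ `[- t, 1]).
  have := (@integrable_mkcond _ _ _ leb _ (EFin \o g) mt).1 gi.
  by apply: integrableS.
apply: (@eq_integrable _ _ _ leb _ mJ) => y; rewrite inE/= => yJ.
rewrite patchE; case: ifPn => // yn; congr EFin; apply/esym.
apply: (eigenfunction_vanish mu0 ge); apply/ltW.
move: (yJ); rewrite in_itv/= => /andP[by_ y1]; apply: below_cutoff => //.
rewrite ltNge; apply/negP => tty; move/negP: yn; apply; rewrite inE/=.
by rewrite in_itv/= tty y1.
Qed.

Lemma eigenfunction_Kop mu g : mu != 0 -> eigenfunction theta a t mu g ->
  forall x, mu * g x = Kop theta b c g x.
Proof.
move=> mu0 ge x; have gi := eigenfunction_on_int mu0 ge.
rewrite -statement_integral//; first by case: ge.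
by move=> y _ /ltW; exact: eigenfunction_vanish mu0 ge.
Qed.

Variables (lambda : R) (h : R -> R).
Hypothesis pp : perron_pair theta b c lambda h.

Let lambda0 := pp_lambda pp.
Let lambdaN0 : lambda != 0. Proof. by rewrite gt_eqF. Qed.
Let hi : on_int b h.
Proof. by apply: mono_on_int (pp_mono pp); exact: ltW left_end_lt1. Qed.

Lemma perron_vanish x : 1 <= theta * x -> h x = 0.
Proof.
by move=> tx; apply: (mulfI lambdaN0); rewrite mulr0 (pp_eigen pp) /Kop tail_int1// mulr0.
Qed.

Lemma perron_eigenfunction : eigenfunction theta a t lambda h.
Proof.
split.
- apply: integrableS hi => //= y /=; rewrite !in_itv/= => /andP[ty ->]; rewrite andbT.
  exact: le_trans left_end_le_cutoff ty.
- by exists 1; rewrite (pp_h1 pp) oner_neq0.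
- move=> x; rewrite statement_integral ?(pp_eigen pp)//.
  by move=> y _ /ltW; exact: perron_vanish.
Qed.

Lemma perron_largest : largest_eigenvalue theta a t lambda.
Proof.
split; first by exists h; exact: perron_eigenfunction.
move=> mu [g ge]; rewrite leNgt; apply/negP => lm.
have mu0 : mu != 0 by rewrite gt_eqF// (lt_trans lambda0).
have g0 := pp_other pp (eigenfunction_on_int mu0 ge)
  (fun x _ => eigenfunction_Kop mu0 ge x) lm.
have [_ [x /eqP gx] _] := ge; apply: gx; apply: (mulfI mu0).
rewrite mulr0 (eigenfunction_Kop mu0 ge).
rewrite (@eq_Kop _ _ _ _ _ (fun y => 0 * h y + 0 * h y)); last first.
  by move=> y yJ; rewrite g0// !mul0r addr0.
by rewrite Kop_lin// !mul0r addr0.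
Qed.

Lemma perron_unique g : eigenfunction theta a t lambda g ->
  exists k : R, forall x, g x = k * h x.
Proof.
move=> ge; exists (g 1) => x.
have gE := pp_unique pp (eigenfunction_on_int lambdaN0 ge)
  (fun x _ => eigenfunction_Kop lambdaN0 ge x).
apply: (mulfI lambdaN0); rewrite (eigenfunction_Kop lambdaN0 ge).
rewrite (@eq_Kop _ _ _ _ _ (fun y => g 1 * h y + 0 * h y)); last first.
  by move=> y yJ; rewrite mul0r addr0 gE.
by rewrite Kop_lin// mul0r addr0 -(pp_eigen pp); ring.
Qed.

End Spectrum.

(** * Processes driven by independent variables *)
Lemma measure_rectangle_unique {R : realType} d1 d2 (T1 : measurableType d1)
    (T2 : measurableType d2) (m1 m2 : {measure set (T1 * T2) -> \bar R}) :
  (m1 setT < +oo)%E ->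
  (forall A B, measurable A -> measurable B -> m1 (A `*` B) = m2 (A `*` B)) ->
  forall D, measurable D -> m1 D = m2 D.
Proof.
move=> m1oo m12 D mD.
pose C : set (set (T1 * T2)) :=
  [set C | exists A, measurable A /\ exists B, measurable B /\ C = A `*` B].
have CI : setI_closed C.
  move=> /= _ _ [X1 [mX1 [X2 [mX2 ->]]]] [Y1 [mY1 [Y2 [mY2 ->]]]].
  rewrite -setXI; exists (X1 `&` Y1); split; first exact: measurableI.
  by exists (X2 `&` Y2); split => //; exact: measurableI.
apply: (measure_unique C (fun=> setT)) => //.
- rewrite measurable_prod_measurableType //; congr (<<s _ >>).
  rewrite predeqE; split => [[A mA [B mB <-]]|[A [mA [B [mB ->]]]]].
    by exists A; split => //; exists B.
  by exists A => //; exists B.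
- by move=> n; exists setT; split => //; exists setT; split => //; rewrite setXTT.
- by rewrite bigcup_const.
- by move=> A [A1 [mA1 [A2 [mA2 ->]]]]; exact: m12.
Qed.

Section Histories.
Context {R : realType}.

Definition last_state n (z : n.+1.-tuple R) : R := tnth z ord_max.

(** The default value of [nth] supplies the last entry. *)
Definition extend n (z : n.-tuple R) (u : R) : n.+1.-tuple R :=
  [tuple nth u z i | i < n.+1].

Definition init n (z : n.+1.-tuple R) : n.-tuple R :=
  [tuple tnth z (widen_ord (leqnSn n) i) | i < n].

Definition hist {T : Type} (Z : nat -> T -> R) k w : k.+1.-tuple R :=
  [tuple Z i.+1 w | i < k.+1].

Lemma hist_last T (Z : nat -> T -> R) k w : last_state (hist Z k w) = Z k.+1 w.
Proof. by rewrite /last_state tnth_mktuple. Qed.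

Lemma hist_extend T (Z : nat -> T -> R) k w :
  hist Z k.+1 w = extend (hist Z k w) (Z k.+2 w).
Proof.
apply: eq_from_tnth => i; rewrite !tnth_mktuple.
have := ltn_ord i; rewrite ltnS leq_eqVlt => /orP[/eqP ->|ik].
  by rewrite nth_default// size_tuple.
by rewrite -[nat_of_ord i]/(nat_of_ord (Ordinal ik)) -tnth_nth tnth_mktuple.
Qed.

Lemma init_extend n (z : n.-tuple R) u : init (extend z u) = z.
Proof.
apply: eq_from_tnth => i; rewrite !tnth_mktuple/=.
by rewrite -tnth_nth.
Qed.

Lemma measurable_last n : measurable_fun setT (@last_state n).
Proof. exact: measurable_tnth. Qed.

Lemma measurable_init n : measurable_fun setT (@init n).
Proof.
apply/measurable_fun_tnthP => i.
rewrite (_ : _ \o _ = fun z => tnth z (widen_ord (leqnSn n) i)).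
  exact: measurable_tnth.
by apply/funext => z /=; rewrite tnth_mktuple.
Qed.

Lemma measurable_extend n :
  measurable_fun setT (fun zu : n.-tuple R * R => extend zu.1 zu.2).
Proof.
apply/measurable_fun_tnthP => i.
have := ltn_ord i; rewrite ltnS leq_eqVlt => /orP[/eqP iE|ik].
  rewrite (_ : _ \o _ = snd); first exact: measurable_snd.
  by apply/funext => -[z u] /=; rewrite tnth_mktuple iE nth_default// size_tuple.
rewrite (_ : _ \o _ = (fun z => tnth z (Ordinal ik)) \o fst).
  by apply: measurableT_comp => //; exact: measurable_tnth.
apply/funext => -[z u] /=; rewrite tnth_mktuple.
by rewrite -[nat_of_ord i]/(nat_of_ord (Ordinal ik)) -tnth_nth.
Qed.

End Histories.

(** Both the conditioned sequence (with [q = snd]) and the limit chain (with the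
    quantile function) have the form [Z_(k+2) = q (Z_(k+1), X_(k+2))]. *)
Section Driven.
Context {R : realType} d (T : measurableType d) (P : probability T R).
Variables (X : nat -> {RV P >-> R}) (mu : probability R R).
Hypothesis X_ind : mutually_independent X.
Hypothesis X_law : forall i B, (0 < i)%N -> measurable B -> P (X i @^-1` B) = mu B.
Variables (q : R * R -> R) (y : R) (Z : nat -> T -> R).
Hypothesis mq : measurable_fun setT q.
Hypotheses (Z1 : forall w, Z 1%N w = y)
  (ZS : forall k w, Z k.+2 w = q (Z k.+1 w, X k.+2 w)).

Lemma measurable_driven k : measurable_fun setT (Z k.+1).
Proof.
elim: k => [|k IH]; first by rewrite (_ : Z 1 = cst y)//; apply/funext => w; exact: Z1.
rewrite (_ : Z k.+2 = fun w => q (Z k.+1 w, X k.+2 w)); last first.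
  by apply/funext => w; exact: ZS.
by apply: measurableT_comp => //; apply/measurable_fun_pairP; split.
Qed.

Lemma measurable_hist k : measurable_fun setT (hist Z k).
Proof.
apply/measurable_fun_tnthP => i.
rewrite (_ : _ \o _ = Z i.+1); first exact: measurable_driven.
by apply/funext => w /=; rewrite tnth_mktuple.
Qed.

Let pair_ k w := (hist Z k w, X k.+2 w).
Let mpair k : measurable_fun setT (pair_ k).
Proof. by apply/measurable_fun_pairP; split => //; exact: measurable_hist. Qed.

Lemma measurable_future (s : seq nat) (B : nat -> set R) :
  (forall i, measurable (B i)) -> measurable (\bigcap_(i in [set` s]) (X i @^-1` B i)).
Proof.
move=> mB; apply: fin_bigcap_measurable => [|i _]; first exact: finite_seq.
by rewrite -[X in measurable X]setTI; exact: measurable_funPT.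
Qed.

(** Independence of the past of [Z] from finitely many later [X_i], by induction
    on the length of the past.  The induction has to carry all later
    rectangles, since the newest variable [X_(k+2)] passes from the future to
    the past. *)
Lemma hist_independent k (A : set (k.+1.-tuple R)) (s : seq nat) (B : nat -> set R) :
  measurable A -> uniq s -> all (fun i => k.+1 < i)%N s -> (forall i, measurable (B i)) ->
  P ((hist Z k @^-1` A) `&` \bigcap_(i in [set` s]) (X i @^-1` B i)) =
  (P (hist Z k @^-1` A) * \prod_(i <- s) P (X i @^-1` B i))%E.
Proof.
elim: k A s B => [|k IH] A s B mA us ks mB.
  have s0 : all (fun i => 0 < i)%N s by apply: sub_all ks => i; exact: ltnW.
  have H w : hist Z 0 w = [tuple y | i < 1].
    by apply: eq_from_tnth => i; rewrite !tnth_mktuple ord1 Z1.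
  have [Ay|nAy] := pselect (A [tuple y | i < 1]).
    have -> : hist Z 0 @^-1` A = setT by apply/seteqP; split=> // w _ /=; rewrite H.
    by rewrite setTI probability_setT mul1e X_ind.
  have -> : hist Z 0 @^-1` A = set0 by apply/seteqP; split=> // w /=; rewrite H.
  by rewrite set0I measure0 mul0e.
set F := \bigcap_(i in [set` s]) _.
have mF : measurable F by exact: measurable_future.
set pF := (\prod_(i <- s) _)%E.
have pF0 : (0 <= pF)%E by apply: prode_ge0 => i _; exact: measure_ge0.
have FE : P F = pF.
  by apply: X_ind => //; apply: sub_all ks => i; exact: leq_ltn_trans.
have pFfin : pF \is a fin_num by rewrite -FE fin_num_measure.
pose D := [set zu : k.+1.-tuple R * R | A (extend zu.1 (q (last_state zu.1, zu.2)))].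
have mD : measurable D.
  rewrite -[D]setTI.
  have : measurable_fun setT (fun zu : k.+1.-tuple R * R => extend zu.1 (q (last_state zu.1, zu.2))).
    have m1 : measurable_fun setT (fun zu : k.+1.-tuple R * R => last_state zu.1).
      exact: (measurableT_comp (@measurable_last R k) measurable_fst).
    have m2 : measurable_fun setT (fun zu : k.+1.-tuple R * R => (last_state zu.1, zu.2)).
      exact: (measurable_fun_pair m1 measurable_snd).
    have m3 := measurableT_comp mq m2.
    have m4 : measurable_fun setT
        (fun zu : k.+1.-tuple R * R => (zu.1, q (last_state zu.1, zu.2))).
      exact: (measurable_fun_pair measurable_fst m3).
    exact: (measurableT_comp (@measurable_extend R k.+1) m4).
  exact.
have HD : hist Z k.+1 @^-1` A = pair_ k @^-1` D.
  by apply/seteqP; split=> w /=; rewrite hist_extend ZS /D/= hist_last.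
rewrite HD.
pose r : {nonneg R} := NngNum (fine_ge0 pF0).
pose m1 := measure_function_pushforward__canonical__measure_function_Measure (mrestr P mF) (@mpair k).
pose m2 := measure_function_pushforward__canonical__measure_function_Measure P (@mpair k).
have key := @measure_rectangle_unique R _ _ _ _ m1 (mscale r m2) _ _ D mD.
move: key; rewrite /= /mscale/= /pushforward /mrestr/= fineK// => ->//.
- by rewrite muleC.
- rewrite preimage_setT setTI.
  by rewrite (le_lt_trans (probability_le1 P mF))// ltry.
move=> A' B' mA' mB'.
(* The rectangle [B'] for [X_(k+2)] is prepended to those of the future. *)
pose B2 i := if i == k.+2 then B' else B i.
have mB2 i : measurable (B2 i) by rewrite /B2; case: ifP.
have ks' : k.+2 \notin s.
  by apply/negP => /(allP ks); rewrite ltnn.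
have B2s i : i \in s -> B2 i = B i.
  by move=> is_; rewrite /B2; case: eqP => // ik; move: ks'; rewrite -ik is_.
have us' : uniq (k.+2 :: s) by rewrite /= ks' us.
have al' : all (fun i => k.+1 < i)%N (k.+2 :: s).
  by rewrite /= ltnS leqnn/=; apply: sub_all ks => i; exact: ltnW.
have e1 := IH A' (k.+2 :: s) B2 mA' us' al' mB2.
have e2 := IH A' [:: k.+2] B2 mA' isT _ mB2.
have E1 : pair_ k @^-1` (A' `*` B') `&` F =
    hist Z k @^-1` A' `&` \bigcap_(i in [set` k.+2 :: s]) (X i @^-1` B2 i).
  apply/seteqP; split=> w /=.
    move=> [[a1 a2] a3]; split => // i /=; rewrite inE => /orP[/eqP ->|is_].
      by rewrite /B2 eqxx.
    by rewrite /= B2s//; exact: a3.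
  move=> [a1 a2]; split; first split => //.
    by have := a2 k.+2; rewrite /= /B2 eqxx; apply; rewrite inE eqxx.
  by move=> i /= is_; have := a2 i; rewrite /= B2s//; apply; rewrite inE is_ orbT.
have E2 : pair_ k @^-1` (A' `*` B') =
    hist Z k @^-1` A' `&` \bigcap_(i in [set` [:: k.+2]]) (X i @^-1` B2 i).
  apply/seteqP; split=> w /=.
    by move=> [a1 a2]; split => // i /=; rewrite inE => /eqP ->; rewrite /B2 eqxx.
  move=> [a1 a2]; split => //.
  by have := a2 k.+2; rewrite /= /B2 eqxx; apply; rewrite inE.
rewrite E1 E2 e1 e2; last by rewrite /= ltnS leqnn.
rewrite big_cons big_seq1 muleA [RHS]muleC; congr (_ * _)%E.
by rewrite big_seq [RHS]big_seq; apply: eq_bigr => i is_; rewrite B2s.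
Qed.

(** The newest variable can be integrated out first: the joint law of the past and
    [X_(k+2)] is a product measure. *)
Lemma expectation_step k (Psi : k.+1.-tuple R * R -> \bar R) :
  measurable_fun setT Psi -> (forall v, 0 <= Psi v)%E ->
  (\int[P]_w Psi (hist Z k w, X k.+2 w) = \int[P]_w \int[mu]_u Psi (hist Z k w, u))%E.
Proof.
move=> mPsi Psi0.
pose H : {mfun T >-> k.+1.-tuple R} := HB.pack (hist Z k)
  (isMeasurableFun.Build _ _ _ _ _ (@measurable_hist k)).
pose pr : {mfun T >-> (k.+1.-tuple R * R)%type} := HB.pack (pair_ k)
  (isMeasurableFun.Build _ _ _ _ _ (@mpair k)).
transitivity (\int[distribution P pr]_v Psi v)%E.
  by rewrite ge0_integral_distribution.
transitivity (\int[distribution P H \x mu]_v Psi v)%E.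
  apply: eq_measure_integral => D mD _; apply/esym.
  apply: (@product_measure_unique _ _ _ _ R (distribution P H) mu (distribution P pr) _ D mD).
  move=> A B mA mB.
  have := @hist_independent k A [:: k.+2] (fun=> B) mA isT _ (fun=> mB).
  rewrite big_seq1 X_law//= /distribution /pushforward => <-; last by rewrite ltnS leqnn.
  congr (P _); apply/seteqP; split=> w /=.
    by move=> [a1 a2]; split => // i /=; rewrite inE => /eqP ->.
  by move=> [a1 a2]; split => //; have := a2 k.+2; apply; rewrite /= inE.
rewrite fubini_tonelli1// /fubini_F ge0_integral_distribution//.
- exact: measurable_fun_fubini_tonelli_F.
- by move=> z; apply: integral_ge0.
Qed.

End Driven.

(** * The quantile function of the tilted step law *)
Section Density.
Context {R : realType} d (T : measurableType d) (mu : {measure set T -> \bar R}).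
Variable f : T -> R.
Hypotheses (mf : measurable_fun setT f) (f0 : forall x, 0 <= f x).

Definition density_measure (A : set T) : \bar R := (\int[mu]_(x in A) (f x)%:E)%E.

Let density0 : density_measure set0 = 0%E.
Proof. by rewrite /density_measure integral_set0. Qed.

Let density_ge0 A : (0 <= density_measure A)%E.
Proof. by apply: integral_ge0 => x _; rewrite lee_fin. Qed.

Let density_sigma_additive : semi_sigma_additive density_measure.
Proof.
move=> /= F mF tF mUF; rewrite /density_measure; apply: cvg_toP.
  apply: ereal_nondecreasing_is_cvgn => m n mn.
  by apply: lee_sum_nneg_natr => // k _ _; exact: density_ge0.
rewrite ge0_integral_bigcup//=.
- by apply: measurable_funTS; exact: measurableT_comp.
- by move=> x _; rewrite lee_fin.
Qed.

Definition density : {measure set T -> \bar R} :=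
  HB.pack density_measure
    (isMeasure.Build _ _ _ density_measure density0 density_ge0 density_sigma_additive).

Lemma densityE A : density A = density_measure A. Proof. by []. Qed.

Let density_indic A : measurable A ->
  (\int[density]_x (\1_A x)%:E = \int[mu]_x ((\1_A x)%:E * (f x)%:E))%E.
Proof.
move=> mA; rewrite integral_indic// setIT densityE /density_measure integral_mkcond.
apply: eq_integral => x _; rewrite patchE indicE; case: (x \in A).
  by rewrite mul1e.
by rewrite mul0e.
Qed.

Import HBNNSimple.

Let density_nnsfun (g : {nnsfun T >-> R}) :
  (\int[density]_x (g x)%:E = \int[mu]_x ((g x)%:E * (f x)%:E))%E.
Proof.
under [LHS]eq_integral do rewrite fimfunE -fsumEFin//.
rewrite [LHS]ge0_integral_fsum//; last 2 first.
  - by move=> r; exact/measurable_EFinP/measurableT_comp.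
  - by move=> n x _; rewrite EFinM nnfun_muleindic_ge0.
under [RHS]eq_integral.
  move=> x xD; rewrite fimfunE -fsumEFin// ge0_mule_fsuml; last first.
    by move=> r; rewrite EFinM nnfun_muleindic_ge0.
  over.
rewrite [RHS]ge0_integral_fsum//; last 2 first.
  - move=> r; apply: emeasurable_funM; last exact/measurable_EFinP.
    by apply/measurable_EFinP; exact: measurableT_comp.
  - move=> n x _; apply: mule_ge0; last by rewrite lee_fin.
    by rewrite EFinM nnfun_muleindic_ge0.
apply: eq_fsbigr => r rg; rewrite integralZl_indic_nnsfun//= density_indic//.
have [r0|r0] := leP 0 r.
  rewrite -ge0_integralZl//.
  - by apply: eq_integral => x _; rewrite muleA.
  - by apply: emeasurable_funM; apply/measurable_EFinP => //; exact: measurable_indic.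
  - by move=> x _; rewrite mule_ge0// lee_fin.
have g0 : g @^-1` [set r] = set0.
  by apply/seteqP; split => // x /= gx; move: r0; rewrite -gx ltNge fun_ge0.
rewrite g0; under eq_integral do rewrite indic0 mul0e.
rewrite integral0 mule0; under eq_integral do rewrite indic0 mulr0 mul0e.
by rewrite integral0.
Qed.

Lemma ge0_integral_density (g : T -> \bar R) :
  measurable_fun setT g -> (forall x, 0 <= g x)%E ->
  (\int[density]_x g x = \int[mu]_x (g x * (f x)%:E))%E.
Proof.
move=> mg g0.
pose g_ := nnsfun_approx measurableT mg.
have mEf : measurable_fun setT (EFin \o f) by exact/measurable_EFinP.
transitivity (lim (\int[density]_x (g_ n x)%:E @[n --> \oo])%E).
  rewrite -monotone_convergence//.
  - by apply: eq_integral => ? /[!inE] xD; apply/esym/cvg_lim => //=; exact: cvg_nnsfun_approx.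
  - by move=> n; exact/measurable_EFinP/measurable_funTS.
  - by move=> n ? _; rewrite lee_fin.
  - by move=> ? _ ? ? mn; rewrite lee_fin; exact/lefP/nd_nnsfun_approx.
transitivity (lim (\int[mu]_x ((g_ n x)%:E * (f x)%:E) @[n --> \oo])%E).
  by apply: congr_lim; apply/funext => n /=; exact: density_nnsfun.
rewrite -monotone_convergence//=.
- apply: eq_integral => x _; apply/cvg_lim => //=.
  apply: cvgeZr => //.
  by apply: cvg_nnsfun_approx.
- by move=> n; apply: emeasurable_funM => //; exact/measurable_EFinP.
- by move=> n ? _; rewrite mule_ge0 ?lee_fin.
- move=> ? _ ? ? mn; rewrite lee_wpmul2r ?lee_fin//; exact/lefP/nd_nnsfun_approx.
Qed.

End Density.

Lemma measure_ray_unique {R : realType} (m1 m2 : {measure set R -> \bar R}) :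
  (m1 setT < +oo)%E -> (forall z, m1 `]z, +oo[%classic = m2 `]z, +oo[%classic) ->
  forall B, measurable B -> m1 B = m2 B.
Proof.
move=> m1oo m12 B mB.
apply: (measure_unique (@RGenOInfty.G R) (fun n => `]- n%:R, +oo[%classic)) => //.
- exact: RGenOInfty.measurableE.
- move=> _ _ [x ->] [y ->]; exists (Num.max x y); apply/seteqP; split=> z /=;
    rewrite !in_itv/= !andbT gt_max; first by move=> [-> ->].
  by move=> /andP[].
- by move=> n; exists (- n%:R).
- apply/seteqP; split=> // x _; have [n hn] : exists n : nat, - x < n%:R.
    by exists (Num.truncn (- x)).+1; exact: truncnS_gt.
  by exists n => //=; rewrite in_itv/= andbT ltrNl.
- by move=> _ [z ->]; exact: m12.
- by move=> n; apply: le_lt_trans m1oo; apply: le_measure; rewrite ?inE.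
Qed.

(** The measure [uniform_prob] lives on the measurable space [measurableTypeR R], whose
    display differs from the one of [R]; the identity transports it. *)
Section UniformLaw.
Context {R : realType}.
Local Notation leb := (@lebesgue_measure R).
Variables (a : R) (a1 : -1 < a).

Lemma measurable_idR : measurable_fun setT (id : measurableTypeR R -> R).
Proof. by move=> _ B mB; rewrite setTI preimage_id. Qed.

Definition idR : {mfun measurableTypeR R >-> R} :=
  HB.pack (id : measurableTypeR R -> R) (isMeasurableFun.Build _ _ _ _ _ measurable_idR).

Definition uniform_law : probability R R := distribution (uniform_prob (lt_Na1 a1)) idR.

Lemma ge0_integral_uniform_law (f : R -> \bar R) :
  measurable_fun setT f -> (forall x, 0 <= f x)%E ->
  (\int[uniform_law]_x f x = (a + 1)^-1%:E * \int[leb]_(x in `[(- a)%R, 1%R]) f x)%E.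
Proof.
move=> mf f0; rewrite ge0_integral_distribution//.
rewrite (_ : (f \o idR) = f)//.
by rewrite (integral_uniform (lt_Na1 a1) mf f0) opprK addrC.
Qed.

End UniformLaw.

Section Quantile.
Context {R : realType}.
Local Notation leb := (@lebesgue_measure R).
Variables (theta a : R).
Hypotheses (theta1 : theta < 1) (a1 : -1 < a).
Local Notation b := (left_end theta a).
Local Notation t := (cutoff theta a).
Local Notation c := (a + 1)^-1.
Variables (lambda : R) (h : R -> R).
Hypothesis pp : perron_pair theta b c lambda h.
Local Notation unif := (uniform_law a1).

Let b1 : b < 1 := left_end_lt1 theta a1.
Let b1' : b <= 1 := ltW b1.
Let c0 : 0 < c := width_inv_gt0 a1.
Let lambda0 : 0 < lambda := pp_lambda pp.
Let hi : on_int b h. Proof. exact: mono_on_int (pp_mono pp). Qed.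
Let h0 := pp_ge0 pp.

(** The step law from [x] is uniform, tilted by [h] and restricted to the successors of
    [x].  Its tail function at [z] is [tail_mass (max z (theta x))] divided by
    [tail_mass (theta x) = lambda (h x)]; thus a single inverse function serves all
    starting points. *)
Definition tail_mass z := c * tail_int b h z.

Lemma tail_mass_anti x y : x <= y -> tail_mass y <= tail_mass x.
Proof. by move=> xy; rewrite ler_wpM2l ?(ltW c0)//; exact: tail_int_anti. Qed.

Lemma tail_mass_ge0 z : 0 <= tail_mass z.
Proof. by rewrite mulr_ge0 ?(ltW c0)// tail_int_ge0. Qed.

Lemma tail_mass1 z : 1 <= z -> tail_mass z = 0.
Proof. by move=> z1; rewrite /tail_mass tail_int1// mulr0. Qed.

Lemma tail_mass_low z : z <= b -> tail_mass z = tail_mass b.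
Proof.
move=> zb; rewrite /tail_mass (tail_int_clamp z b1' hi).
by rewrite /clamp (max_idPl zb) (min_idPr b1').
Qed.

Lemma tail_mass_eigen x : tail_mass (theta * x) = lambda * h x.
Proof. by rewrite (pp_eigen pp). Qed.

Lemma perron_h_bounded : exists2 M : R, 0 < M & forall x, x \in `[b, 1] -> h x <= M.
Proof.
have bJ : b \in `[b, 1] by rewrite in_itv/= lexx.
have J1 : 1 \in `[b, 1] by rewrite in_itv/= lexx b1'.
exists (h b + h 1); first by rewrite (pp_h1 pp) ltr_wpDl// h0.
move=> x xJ; have := pp_mono pp xJ J1; have := pp_mono pp bJ xJ.
have := h0 bJ; have := h0 J1; move: xJ; rewrite in_itv/= => /andP[bx x1].
move=> k1 k2 /(_ bx) m1 /(_ x1) m2.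
by case: (theta < 0) m1 m2 => m1 m2; lra.
Qed.

Lemma tail_mass_lip : exists2 M : R, 0 < M &
  forall x y, x <= y -> tail_mass x - tail_mass y <= M * (y - x).
Proof.
have [M M0 hM] := perron_h_bounded; exists (c * M); first exact: mulr_gt0.
move=> x y xy; rewrite /tail_mass -mulrBr -mulrA ler_wpM2l ?(ltW c0)//.
have := @tail_int_bounds _ b h x y 0 M b1' hi xy.
case/(_ _)/andP; first by move=> z zJ _ _; rewrite h0//= hM.
move=> _ /le_trans; apply; rewrite ler_wpM2l ?(ltW M0)//.
rewrite /clamp /Num.min /Num.max; do ?case: ifP; lra.
Qed.

(** The maximum with [0] makes the set nonempty for all [r], whence [tail_inv] is
    monotone, and therefore measurable, on the whole line. *)
Definition tail_inv r := inf [set z | b <= z <= 1 /\ tail_mass z <= Num.max 0 r].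

Let inv_has_inf r : has_inf [set z | b <= z <= 1 /\ tail_mass z <= Num.max 0 r].
Proof.
split; last by exists b => z [] /andP[].
by exists 1; rewrite /= b1' lexx tail_mass1// le_max lexx.
Qed.

Lemma tail_inv_le1 r : tail_inv r <= 1.
Proof.
apply: (ge_inf (inv_has_inf r).2) => /=.
by rewrite b1' lexx tail_mass1// le_max lexx.
Qed.

Lemma tail_inv_geb r : b <= tail_inv r.
Proof. by apply: lb_le_inf; [exact: (inv_has_inf r).1|move=> z [] /andP[]]. Qed.

(** The infimum is attained because [tail_mass] is continuous. *)
Lemma lt_tail_inv r z : 0 <= r -> (z < tail_inv r) = (z < b) || (r < tail_mass z).
Proof.
move=> r0; have [zb|bz] := ltP z b; first by rewrite (lt_le_trans zb)// tail_inv_geb.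
rewrite /=; have [rz|zr] := ltP r (tail_mass z).
  have [M M0 hM] := tail_mass_lip.
  pose e := (tail_mass z - r) / (2 * M).
  have e0 : 0 < e by rewrite divr_gt0 ?subr_gt0// mulr_gt0.
  apply: (@lt_le_trans _ _ (z + e)); first by rewrite ltrDl.
  apply: lb_le_inf; first exact: (inv_has_inf r).1.
  move=> w [_ /=]; rewrite (max_idPr r0) => wr; rewrite leNgt; apply/negP => we.
  have h1 : tail_mass (z + e) <= r by apply: le_trans wr; apply: tail_mass_anti; exact: ltW.
  have := hM z (z + e); rewrite lerDl => /(_ (ltW e0)).
  rewrite addrAC subrr add0r => h2.
  have h3 : M * e = (tail_mass z - r) / 2 by rewrite /e; field; rewrite gt_eqF.
  lra.
apply/negbTE; rewrite -leNgt; have [z1|z1] := leP z 1; last first.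
  by apply: le_trans (ltW z1); exact: tail_inv_le1.
apply: (ge_inf (inv_has_inf r).2) => /=.
by rewrite bz z1 (max_idPr r0).
Qed.

Lemma tail_mass_inv r : 0 <= r -> tail_mass (tail_inv r) <= r.
Proof.
move=> r0; have := lt_tail_inv (tail_inv r) r0; rewrite ltxx => /esym/negbT.
by rewrite negb_or -!leNgt => /andP[].
Qed.

Lemma tail_inv_anti x y : x <= y -> tail_inv y <= tail_inv x.
Proof.
have E r : tail_inv r = tail_inv (Num.max 0 r).
  by rewrite /tail_inv (max_idPr (_ : 0 <= Num.max 0 r))// le_max lexx.
move=> xy; rewrite E (E x).
have x0 : 0 <= Num.max 0 x by rewrite le_max lexx.
have y0 : 0 <= Num.max 0 y by rewrite le_max lexx.
rewrite leNgt lt_tail_inv// negb_or -!leNgt tail_inv_geb/=.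
apply: le_trans (tail_mass_inv x0) _.
by rewrite ge_max !le_max lexx xy orbT.
Qed.

(** Values in [[0, 1[] only: the value [1] would send some points to [b], which can lie
    outside the effective state space. *)
Definition unit_scale u := if (- a <= u) && (u < 1) then (u + a) * c else 0.

Lemma unit_scale_ge0 u : 0 <= unit_scale u.
Proof.
rewrite /unit_scale; case: ifP => // /andP[au u1].
by rewrite mulr_ge0 ?(ltW c0)//; lra.
Qed.

Lemma unit_scale_lt1 u : unit_scale u < 1.
Proof.
rewrite /unit_scale; case: ifP => // /andP[au u1].
by rewrite ltr_pdivrMr ?mul1r; lra.
Qed.

Definition quantile (xu : R * R) := tail_inv (unit_scale xu.2 * tail_mass (theta * xu.1)).

Lemma measurable_unit_scale : measurable_fun setT unit_scale.
Proof.
apply: measurable_fun_ifT => //=.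
- apply: measurable_and; first exact: measurable_fun_ler.
  exact: measurable_fun_ltr.
- by apply: measurable_funM => //; apply: measurable_funD.
Qed.

Lemma measurable_quantile : measurable_fun setT quantile.
Proof.
have m1 : measurable_fun setT tail_inv.
  by apply: nonincreasing_measurable => // x y; exact: tail_inv_anti.
have m2 : measurable_fun setT tail_mass.
  by apply: nonincreasing_measurable => // x y; exact: tail_mass_anti.
apply: (measurableT_comp m1); apply: measurable_funM.
  exact: (measurableT_comp measurable_unit_scale measurable_snd).
apply: (measurableT_comp m2); apply: measurable_funM => //.
Qed.

(** The new point has a tail mass smaller than the total mass, whereas points
    without successors carry no mass of [h] and have full tail mass. *)
Lemma quantile_state x u : state_space theta t x ->
  state_space theta t (quantile (x, u)).
Proof.
move=> /state_spaceE -/(_ theta1 a1)[xJ tx]; apply/state_spaceE => //.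
set r := unit_scale u * tail_mass (theta * x).
have g0 : 0 < tail_mass (theta * x) by rewrite tail_mass_eigen mulr_gt0// (pp_gt0 pp).
have r0 : 0 <= r by rewrite mulr_ge0 ?unit_scale_ge0// ltW.
have rg : r < tail_mass (theta * x) by rewrite /r gtr_pMl// unit_scale_lt1.
have qb := tail_inv_geb r; have q1 := tail_inv_le1 r.
rewrite /quantile /= -/r; split; first by rewrite in_itv/= qb q1.
rewrite ltNge; apply/negP => tq.
have tneg : theta < 0.
  rewrite ltNge; apply/negP => t0.
  have tt : theta * tail_inv r <= theta by rewrite -[leRHS]mulr1 ler_wpM2l.
  by have := le_lt_trans (le_trans tq tt) theta1; rewrite ltxx.
have : tail_mass b <= tail_mass (tail_inv r).
  rewrite -subr_le0 /tail_mass -mulrBr pmulr_rle0//.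
  have := @tail_int_bounds _ b h b (tail_inv r) 0 0 b1' hi qb.
  case/(_ _)/andP; last by rewrite !mul0r.
  move=> y yJ _ yq; rewrite (perron_vanish pp) ?lexx//.
  by apply: le_trans tq _; rewrite ler_wnM2l// ltW.
have := tail_mass_inv r0.
have : tail_mass (theta * x) <= tail_mass b.
  by have [xb|bx] := leP (theta * x) b; [rewrite tail_mass_low|apply: tail_mass_anti; exact: ltW].
move=> h1 h2 h3; have := le_lt_trans (le_trans h1 (le_trans h3 h2)) rg.
by rewrite ltxx.
Qed.

Lemma lt_quantile x u z : state_space theta t x ->
  (z < quantile (x, u)) = (unit_scale u < tail_mass z / tail_mass (theta * x)).
Proof.
move=> /state_spaceE -/(_ theta1 a1)[xJ tx].
have g0 : 0 < tail_mass (theta * x) by rewrite tail_mass_eigen mulr_gt0// (pp_gt0 pp).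
rewrite /quantile lt_tail_inv; last by rewrite mulr_ge0 ?unit_scale_ge0 ?tail_mass_ge0.
rewrite ltr_pdivlMr//=; have [zb|//] := ltP z b; rewrite /= (tail_mass_low (ltW zb)).
apply/esym; apply: (@lt_le_trans _ _ (tail_mass (theta * x))).
  by rewrite gtr_pMl// unit_scale_lt1.
by have [xb|bx] := leP (theta * x) b; [rewrite tail_mass_low|apply: tail_mass_anti; exact: ltW].
Qed.

Lemma unif_scale s : 0 <= s -> unif [set u | unit_scale u < s] = (Num.min 1 s)%:E.
Proof.
move=> s0.
have mD : measurable [set u | unit_scale u < s].
  rewrite -[X in measurable X]setTI.
  have := measurable_unit_scale measurableT (measurable_itv `]-oo, s[).
  by congr measurable; apply/seteqP; split=> u /=; rewrite in_itv.
have [s1|s1] := leP 1 s.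
  rewrite (_ : [set u | _] = setT) ?probability_setT//.
  by apply/seteqP; split=> // u _; exact: lt_le_trans (unit_scale_lt1 u) s1.
have sE : c * (s * (a + 1)) = s by rewrite mulrCA mulVf ?mulr1// gt_eqF// -ltrBlDr sub0r.
have pa : 0 < a + 1 by rewrite -ltrBlDr sub0r.
have -> : unif [set u | unit_scale u < s] =
    (\int[unif]_u (\1_[set u | unit_scale u < s] u)%:E)%E.
  by rewrite integral_indic// setIT.
rewrite ge0_integral_uniform_law//; last first.
  by apply/measurable_EFinP; exact: measurable_indic.
rewrite integral_indic//.
pose p := s * (a + 1) - a.
have pE : (p <= 1)%R by rewrite /p lerBlDr -[leRHS]mul1r [1 + a]addrC ler_wpM2r// ltW.
have ap : - a <= p by rewrite /p lerDr mulr_ge0// ltW.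
have lebp : leb `[- a, p[ = (s * (a + 1))%:E.
  rewrite lebesgue_measure_itv/= lte_fin /p; case: ifPn => [_|].
    by rewrite -EFinB; congr EFin; ring.
  rewrite -leNgt => h1; congr EFin; have : 0 <= s * (a + 1) by rewrite mulr_ge0// ltW.
  by move=> ?; apply/eqP; rewrite eq_le; apply/andP; split; lra.
have scaleE u : - a <= u -> u < 1 -> (unit_scale u < s) = (u < p).
  by move=> au u1; rewrite /unit_scale au u1/= ltr_pdivrMr// /p ltrBrDr.
have lebA : leb ([set u | unit_scale u < s] `&` `[- a, 1]) = (s * (a + 1))%:E.
  apply/eqP; rewrite eq_le; apply/andP; split.
    apply: (@le_trans _ _ (leb (`[- a, p[ `|` [set 1]))).
      apply: le_measure; rewrite ?inE.
      - by apply: measurableI.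
      - by apply: measurableU.
      move=> u [/= us]; rewrite in_itv/= => /andP[au]; rewrite le_eqVlt => /predU1P[->|u1].
        by right.
      by left; rewrite /= in_itv/= au -scaleE.
    apply: (@le_trans _ _ (leb `[(- a)%R, p[ + leb [set 1%R])%E); first exact: measureU2.
    by rewrite lebp lebesgue_measure_set1 adde0.
  rewrite -lebp; apply: le_measure; rewrite ?inE//.
  - by apply: measurableI.
  move=> u /=; rewrite in_itv/= => /andP[au up].
  have u1 : u < 1 by exact: lt_le_trans pE.
  by split; [rewrite scaleE|rewrite in_itv/= au ltW].
rewrite -[in RHS]sE EFinM; congr (_ * _)%E; exact: lebA.
Qed.
End Quantile.

Section PushKernel.
Context {R : realType} (mu : probability R R) (q : R * R -> R).
Hypothesis mq : measurable_fun setT q.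

Lemma measurable_section x : measurable_fun setT (fun u => q (x, u)).
Proof. by apply: (measurableT_comp mq); exact: measurable_fun_pair. Qed.

Definition push_fun x : {mfun R >-> R} := HB.pack (fun u => q (x, u))
  (isMeasurableFun.Build _ _ _ _ _ (@measurable_section x)).

Definition push_kernel (x : R) : {measure set R -> \bar R} := distribution mu (push_fun x).

Let measurable_push U : measurable U -> measurable_fun setT (push_kernel ^~ U).
Proof.
move=> mU.
have mqU : measurable (q @^-1` U) by rewrite -[X in measurable X]setTI; exact: mq.
have := measurable_fun_xsection mu mqU.
apply: eq_measurable_fun => x _ /=; congr (mu _).
by apply/seteqP; split=> u; rewrite /xsection/= inE.
Qed.

HB.instance Definition _ := isKernel.Build _ _ R R R push_kernel measurable_push.

Let push_prob x : push_kernel x setT = 1%E.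
Proof. by rewrite /push_kernel/= probability_setT. Qed.

HB.instance Definition _ := Kernel_isProbability.Build _ _ R R R push_kernel push_prob.

Definition push_pker : R.-pker R ~> R := push_kernel.

Lemma push_pkerE x B : push_pker x B = mu [set u | B (q (x, u))].
Proof. by []. Qed.

End PushKernel.

Section StepLaw.
Context {R : realType}.
Local Notation leb := (@lebesgue_measure R).
Variables (theta a : R).
Hypotheses (theta1 : theta < 1) (a1 : -1 < a).
Local Notation b := (left_end theta a).
Local Notation t := (cutoff theta a).
Local Notation c := (a + 1)^-1.

Lemma measurable_step_set : measurable (step_set theta a).
Proof.
have m1 : measurable_fun setT (fst : R * R -> R) by exact: measurable_fst.
have m2 : measurable_fun setT (snd : R * R -> R) by exact: measurable_snd.
have mI : measurable (`[- a, 1]%classic : set R) by [].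
have -> : step_set theta a = (fst @^-1` `[- a, 1]%classic) `&`
    ((snd @^-1` `[- a, 1]%classic) `&` ((fun z => z.1 - theta * z.2) @^-1` `]0, +oo[%classic)).
  apply/seteqP; split=> z [h1 [h2 h3]]; split=> //; split=> //.
    by rewrite /= in_itv/= andbT subr_gt0.
  by move: h3; rewrite /= in_itv/= andbT subr_gt0.
apply: measurableI; first by rewrite -[X in measurable X]setTI; exact: m1.
apply: measurableI; first by rewrite -[X in measurable X]setTI; exact: m2.
have m3 : measurable_fun setT (fun z : R * R => z.1 - theta * z.2).
  by apply: measurable_funB => //; exact: measurable_funM.
by rewrite -[X in measurable X]setTI; exact: m3.
Qed.

Lemma step_stays x u : x \in `[b, 1] -> - a <= u -> theta * x < u -> b <= u.
Proof.
rewrite in_itv/= /left_end; case: ifPn => // /negP t0 /andP[bx x1] au xu.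
rewrite ge_max au andbT; apply: le_trans (ltW xu); apply: mulr_ge0.
  by rewrite leNgt; apply/negP.
by apply: le_trans bx; rewrite le_max lexx.
Qed.

Lemma step_setE x u : x \in `[b, 1] ->
  step_set theta a (u, x) <-> u \in `[b, 1] /\ theta * x < u.
Proof.
move=> xJ; have ab := left_end_ge theta a; split.
  move=> [/=]; rewrite !in_itv/= => /andP[au u1] [_ xu]; split => //.
  by rewrite u1 andbT; exact: step_stays xJ au xu.
move=> [/=]; rewrite in_itv/= => /andP[bu u1] xu; split; first by rewrite in_itv/= u1 (le_trans ab).
split=> //=; move: xJ; rewrite !in_itv/= => /andP[bx ->]; rewrite andbT.
exact: le_trans bx.
Qed.

Variables (lambda : R) (h : R -> R).
Hypothesis pp : perron_pair theta b c lambda h.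
Local Notation unif := (uniform_law a1).
Local Notation tail_mass := (tail_mass theta a h).
Local Notation quantile := (quantile theta a h).

Let b1 : b < 1 := left_end_lt1 theta a1.
Let c0 : 0 < c := width_inv_gt0 a1.
Let lambda0 : 0 < lambda := pp_lambda pp.
Let hi : on_int b h. Proof. by apply: mono_on_int (pp_mono pp); exact: ltW. Qed.

Lemma perron_ge0 x : 0 <= h x.
Proof.
by rewrite -(pmulr_rge0 _ lambda0) -(tail_mass_eigen pp) (tail_mass_ge0 a1 pp).
Qed.

Lemma measurable_perron : measurable_fun setT h.
Proof.
rewrite (_ : h = fun x => lambda^-1 * tail_mass (theta * x)); last first.
  by apply/funext => x; rewrite (tail_mass_eigen pp)// mulKf// gt_eqF.
apply: measurable_funM => //.
have m2 : measurable_fun setT tail_mass.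
  by apply: nonincreasing_measurable => // x y; exact: (tail_mass_anti a1 pp).
by apply: (measurableT_comp m2); exact: measurable_funM.
Qed.

(** Density of the step law with respect to the uniform law. *)
Definition tilt x u : R := \1_(step_set theta a) (u, x) * (h u / h x) * lambda^-1.

Lemma tilt_ge0 x u : 0 <= tilt x u.
Proof. by rewrite !mulr_ge0 ?invr_ge0 ?perron_ge0// ltW. Qed.

Lemma measurable_tilt x : measurable_fun setT (tilt x).
Proof.
apply: measurable_funM => //; apply: measurable_funM; last first.
  by apply: measurable_funM => //; exact: measurable_perron.
have m1 : measurable_fun setT (\1_(step_set theta a) : R * R -> R).
  by apply: measurable_indic; exact: measurable_step_set.
by apply: (measurableT_comp m1); exact: measurable_fun_pair.
Qed.

Lemma state_tail x : state_space theta t x ->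
  x \in `[b, 1] /\ 0 < tail_mass (theta * x).
Proof.
move=> /state_spaceE -/(_ theta1 a1)[xJ tx]; split => //.
by rewrite (tail_mass_eigen pp) mulr_gt0// (pp_gt0 pp).
Qed.

Lemma tilt_ray x z : state_space theta t x ->
  density unif (@measurable_tilt x) (tilt_ge0 x) `]z, +oo[%classic =
  (tail_mass (Num.max z (theta * x)) / tail_mass (theta * x))%:E.
Proof.
move=> sx; have [xJ g0] := state_tail sx.
set p := Num.max z (theta * x).
have hx0 : 0 < h x by rewrite -(pmulr_rgt0 _ lambda0) -(tail_mass_eigen pp).
pose k := (lambda * h x)^-1.
have k0 : 0 <= k by rewrite invr_ge0 ltW// mulr_gt0.
have mt := measurable_tail b p.
rewrite densityE /density_measure integral_mkcond.
rewrite ge0_integral_uniform_law; first last.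
- move=> u; rewrite patchE; case: ifP => // _; rewrite lee_fin; exact: tilt_ge0.
- by apply/measurable_restrict => //; apply/measurable_funTS/measurable_EFinP; exact: measurable_tilt.
have -> : (\int[leb]_(u in `[(- a)%R, 1%R]) ((fun u => (tilt x u)%:E) \_ `]z, +oo[%classic) u =
   \int[leb]_(u in tail b p) (k%:E * (h u)%:E))%E.
  rewrite integral_mkcond [RHS]integral_mkcond; apply: eq_integral => u _.
  rewrite !patchE; case: ifPn => [|ua].
    rewrite inE/= in_itv/= => /andP[au u1]; case: ifPn => [|uz].
      rewrite inE/= in_itv/= andbT => zu.
      rewrite /tilt indicE; have [su|nsu] := pselect (step_set theta a (u, x)).
        have [uJ xu] := (step_setE u xJ).1 su.
        rewrite mem_set// mul1r ifT; first by rewrite -EFinM /k; congr EFin; field; rewrite !gt_eqF.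
        by rewrite inE; split => //=; rewrite gt_max zu.
      rewrite memNset// !mul0r; case: ifPn => //; rewrite inE => -[/=].
      rewrite gt_max => /andP[_ xu] uJ; exfalso; apply: nsu.
      by apply/step_setE.
    case: ifPn => //; rewrite inE => -[/=]; rewrite gt_max => /andP[zu _] _.
    by move/negP: uz; case; rewrite inE/= in_itv/= zu.
  case: ifPn => //; rewrite inE => -[_ /=]; rewrite in_itv/= => /andP[bu u1].
  move/negP: ua; case; rewrite inE/= in_itv/= u1 andbT.
  exact: le_trans (left_end_ge theta a) bu.
have ht : leb.-integrable (tail b p) (EFin \o h) by exact: on_int_tail.
rewrite (@integralZl _ _ _ leb _ mt _ ht).
have hfin := @integrable_fin_num _ _ _ leb _ mt _ ht.
rewrite -(fineK hfin) -!EFinM; congr EFin.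
rewrite (tail_mass_eigen pp) /tail_mass /tail_int /Rintegral /k/=.
by rewrite mulrCA mulrC.
Qed.

Lemma quantile_law x B : state_space theta t x -> measurable B ->
  unif [set u | B (quantile (x, u))] = density unif (@measurable_tilt x) (tilt_ge0 x) B.
Proof.
move=> sx mB; have [xJ g0] := state_tail sx.
have mq := measurable_quantile a1 pp.
pose m1 : probability R R := push_kernel unif mq x.
have m1T : (m1 setT < +oo)%E by rewrite probability_setT ltry.
have := @measure_ray_unique R m1 (density unif (@measurable_tilt x) (tilt_ge0 x)) m1T _ B mB.
apply=> z; rewrite tilt_ray// /m1/= /distribution /pushforward/=.
have -> : (fun u => quantile (x, u)) @^-1` `]z, +oo[ =
    [set u | unit_scale a u < tail_mass z / tail_mass (theta * x)].
  by apply/seteqP; split=> u /=; rewrite in_itv/= andbT (lt_quantile theta1 a1 pp).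
rewrite unif_scale//; last by rewrite divr_ge0 ?(tail_mass_ge0 a1 pp).
congr EFin; have [xz|zx] := leP (theta * x) z.
  by rewrite (min_idPr _)// ler_pdivrMr// mul1r; exact: (tail_mass_anti a1 pp).
rewrite divff ?gt_eqF// (min_idPl _)// ler_pdivlMr// mul1r.
by apply: (tail_mass_anti a1 pp); exact: ltW.
Qed.

Lemma tilt_reduced_kernel x B : state_space theta t x -> measurable B ->
  density unif (@measurable_tilt x) (tilt_ge0 x) B = reduced_kernel theta a t lambda h x B.
Proof.
move=> sx mB; have [xJ g0] := state_tail sx.
have mtl : measurable_fun setT (fun u => (tilt x u)%:E).
  by apply/measurable_EFinP; exact: measurable_tilt.
rewrite densityE /density_measure integral_mkcond.
rewrite ge0_integral_uniform_law; first last.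
- move=> u; rewrite patchE; case: ifP => // _; rewrite lee_fin; exact: tilt_ge0.
- by apply/measurable_restrict => //; exact: measurable_funTS.
rewrite -ge0_integralZl//; last 3 first.
- by apply: measurable_funTS; apply/measurable_restrict => //; exact: measurable_funTS.
- by move=> u _; rewrite patchE; case: ifP => // _; rewrite lee_fin; exact: tilt_ge0.
- by rewrite lee_fin ltW.
rewrite /reduced_kernel integral_mkcond [RHS]integral_mkcond; apply: eq_integral => u _.
have at_ : - a <= - t := le_trans (left_end_ge theta a) (left_end_le_cutoff theta a).
rewrite !patchE; case: ifPn => [|ua].
  rewrite inE/= in_itv/= => /andP[au u1]; case: ifPn => [uB|uB].
    case: ifPn => [_|ut]; first by rewrite -EFinM /tilt; congr EFin; ring.
    rewrite /tilt indicE; have [su|nsu] := pselect (step_set theta a (u, x)).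
      have [uJ xu] := (step_setE u xJ).1 su.
      have tu : u < - t.
        rewrite ltNge; apply/negP => tu; move/negP: ut; case.
        by rewrite inE; split; [exact/set_mem|rewrite /= in_itv/= tu].
      rewrite (perron_vanish pp) ?mul0r ?mulr0 ?mul0r ?mule0//.
      by apply/ltW; apply: below_cutoff tu => //; move: uJ; rewrite in_itv/= => /andP[].
    by rewrite memNset// !mul0r mule0.
  case: ifPn => [|_]; last by rewrite mule0.
  by rewrite inE => -[uB']; move/negP: uB; case; rewrite inE.
case: ifPn => //; rewrite inE => -[_ /=]; rewrite in_itv/= => /andP[tu u1].
by move/negP: ua; case; rewrite inE/= in_itv/= u1 andbT (le_trans at_).
Qed.

End StepLaw.

(** * Conditioning on survival *)
Section Survival.
Context {R : realType}.
Local Notation leb := (@lebesgue_measure R).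
Variables (theta a : R).
Hypotheses (theta1 : theta < 1) (a1 : -1 < a).
Local Notation b := (left_end theta a).
Local Notation t := (cutoff theta a).
Local Notation c := (a + 1)^-1.
Local Notation unif := (uniform_law a1).
Local Notation surv := (surv theta b c).

Let b1 : b < 1 := left_end_lt1 theta a1.
Let c0 : 0 < c := width_inv_gt0 a1.

Lemma measurable_step_from x : measurable_fun setT (fun u => \1_(step_set theta a) (u, x) : R).
Proof.
have m1 : measurable_fun setT (\1_(step_set theta a) : R * R -> R).
  by apply: measurable_indic; exact: measurable_step_set.
by apply: (measurableT_comp m1); exact: measurable_fun_pair.
Qed.

Lemma step_integral x (f : R -> R) : x \in `[b, 1] -> measurable_fun setT f ->
  (forall u, 0 <= f u) -> on_int b f ->
  (\int[unif]_u (\1_(step_set theta a) (u, x) * f u)%:E = (Kop theta b c f x)%:E)%E.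
Proof.
move=> xJ mf f0 fi; have mt := measurable_tail b (theta * x).
have ft : leb.-integrable (tail b (theta * x)) (EFin \o f) by exact: on_int_tail.
rewrite ge0_integral_uniform_law; first last.
- by move=> u; rewrite lee_fin mulr_ge0.
- by apply/measurable_EFinP; apply: measurable_funM => //; exact: measurable_step_from.
have -> : (\int[leb]_(u in `[(- a)%R, 1%R]) (\1_(step_set theta a) (u, x) * f u)%:E =
   \int[leb]_(u in tail b (theta * x)) (f u)%:E)%E.
  rewrite integral_mkcond [RHS]integral_mkcond; apply: eq_integral => u _.
  rewrite !patchE.
  have [ut|ut] := boolP (u \in tail b (theta * x)).
    move: (ut); rewrite inE => -[/= xu uJ].
    have su : step_set theta a (u, x) by apply/(step_setE u xJ); split.
    rewrite ifT; first by rewrite indicE mem_set// mul1r.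
    by rewrite inE; case: su.
  case: ifPn => // _; rewrite indicE memNset ?mul0r// => /(step_setE u xJ)[uJ xu].
  by move/negP: ut; case; rewrite inE; split.
have ffin := @integrable_fin_num _ _ _ leb _ mt _ ft.
by rewrite -(fineK ffin) -EFinM.
Qed.

Lemma measurable_surv i : measurable_fun setT (surv i).
Proof.
have si : on_int b (surv i) := (surv_chain theta b1 c0 i).1.
have m : measurable_fun (`[b, 1]%classic : set R) (surv i).
  by apply/measurable_EFinP; have /integrableP[] := si.
have -> : surv i = (surv i \_ `[b, 1]%classic).
  apply/funext => x; rewrite patchE; case: ifPn => //.
  by rewrite notin_setE /= => /negP/negbTE xJ; case: i {si m} => [|i] /=; rewrite xJ.
exact/(measurable_restrictT (surv i) (measurable_itv `[b, 1])).
Qed.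

Section Process.
Context d (T : measurableType d) (P : probability T R) (X : nat -> {RV P >-> R}).
Hypothesis hX : iid_uniform a1 X.
Variable y : R.
Hypothesis yJ : y \in `[b, 1].
Let Z := started_at X y.

Lemma X_law i B : (0 < i)%N -> measurable B -> P (X i @^-1` B) = unif B.
Proof. by move=> i0 mB; have := hX.2 i i0 B mB. Qed.

Lemma started1 w : Z 1%N w = y. Proof. by []. Qed.
Lemma startedS k w : Z k.+2 w = snd (Z k.+1 w, X k.+2 w). Proof. by []. Qed.

Let mZ k : measurable_fun setT (Z k.+1).
Proof. exact: (measurable_driven (@measurable_snd _ _ R R) started1 startedS). Qed.

Definition steps m i : set T :=
  [set w | forall l, (m < l <= m + i)%N -> step_set theta a (pair_process Z l w)].

Lemma steps0 m : steps m 0 = setT.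
Proof.
by apply/seteqP; split=> // w _ l; rewrite addn0 => /andP[h1 h2]; move: (leq_trans h1 h2); rewrite ltnn.
Qed.

Lemma stepsS m i w : steps m i.+1 w <->
  step_set theta a (Z m.+2 w, Z m.+1 w) /\ steps m.+1 i w.
Proof.
split=> [h|[h1 h2] l /andP[ml li]].
  split; first by apply: (h m.+1); rewrite leqnn -addn1 leq_add2l.
  by move=> l /andP[ml li]; apply: h; rewrite (ltnW ml) addnS -addSn.
move: ml; rewrite leq_eqVlt => /predU1P[<-//|ml].
by apply: h2; rewrite ml addSn -addnS.
Qed.

Lemma measurable_steps m i : measurable (steps m i).
Proof.
elim: i m => [|i IH] m; first by rewrite steps0.
have -> : steps m i.+1 =
    ((fun w => (Z m.+2 w, Z m.+1 w)) @^-1` (step_set theta a)) `&` steps m.+1 i.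
  by apply/seteqP; split=> w /=; move/stepsS.
apply: measurableI => //; rewrite -[X in measurable X]setTI.
have := measurable_fun_pair (mZ m.+1) (mZ m); apply => //.
exact: measurable_step_set.
Qed.

(** Integrating out the last [i] variables one by one turns the indicator of the last
    [i] steps into [surv i] at the present point. *)
Lemma survival i m (Phi : m.+1.-tuple R -> R) : measurable_fun setT Phi ->
  (forall z, 0 <= Phi z) -> (forall w, Phi (hist Z m w) != 0 -> Z m.+1 w \in `[b, 1]) ->
  (\int[P]_w (Phi (hist Z m w) * \1_(steps m i) w)%:E =
   \int[P]_w (Phi (hist Z m w) * surv i (Z m.+1 w))%:E)%E.
Proof.
elim: i m Phi => [|i IH] m Phi mPhi Phi0 PhiJ.
  apply: eq_integral => w _; rewrite steps0 indicT; congr EFin.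
  have [->|nz] := eqVneq (Phi (hist Z m w)) 0; first by rewrite !mul0r.
  by rewrite /= PhiJ.
pose Phi' (z : m.+2.-tuple R) : R :=
  Phi (init z) * \1_(step_set theta a) (last_state z, last_state (init z)).
have mS : measurable_fun setT (\1_(step_set theta a) : R * R -> R).
  by apply: measurable_indic; exact: measurable_step_set.
have mPhi' : measurable_fun setT Phi'.
  apply: measurable_funM; first exact: (measurableT_comp mPhi (@measurable_init R m.+1)).
  apply: (measurableT_comp mS); apply: measurable_fun_pair; first exact: measurable_last.
  exact: (measurableT_comp (@measurable_last R m) (@measurable_init R m.+1)).
have Hinit w : init (hist Z m.+1 w) = hist Z m w by rewrite hist_extend init_extend.
have Phi'E w : Phi' (hist Z m.+1 w) =
    Phi (hist Z m w) * \1_(step_set theta a) (Z m.+2 w, Z m.+1 w).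
  by rewrite /Phi' Hinit !hist_last.
transitivity (\int[P]_w (Phi' (hist Z m.+1 w) * \1_(steps m.+1 i) w)%:E)%E.
  apply: eq_integral => w _; congr EFin; rewrite Phi'E -mulrA; congr (_ * _).
  rewrite !indicE; have [/stepsS[s1 s2]|ns] := pselect (steps m i.+1 w).
    by rewrite !mem_set//; [rewrite mulr1|apply/stepsS].
  rewrite memNset//; have [s1|ns1] := pselect (step_set theta a (Z m.+2 w, Z m.+1 w)).
    have [s2|ns2] := pselect (steps m.+1 i w); first by case: ns; apply/stepsS.
    by rewrite (memNset ns2) mulr0.
  by rewrite (memNset ns1) mul0r.
rewrite IH//; last 2 first.
- by move=> z; rewrite mulr_ge0.
- move=> w; rewrite Phi'E mulf_eq0 negb_or => /andP[/PhiJ ZJ].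
  rewrite indicE; case: (boolP (_ \in _)) => [|_]; last by rewrite eqxx.
  by rewrite inE => /(step_setE _ ZJ)[].
pose Psi (v : m.+1.-tuple R * R) : \bar R :=
  ((Phi v.1)%:E * (\1_(step_set theta a) (v.2, last_state v.1) * surv i v.2)%:E)%E.
have mPsi : measurable_fun setT Psi.
  apply: emeasurable_funM; apply/measurable_EFinP.
    exact: (measurableT_comp mPhi measurable_fst).
  apply: measurable_funM; last exact: (measurableT_comp (measurable_surv i) measurable_snd).
  apply: (measurableT_comp mS); apply: measurable_fun_pair => //.
  exact: (measurableT_comp (@measurable_last R m) measurable_fst).
transitivity (\int[P]_w Psi (hist Z m w, X m.+2 w))%E.
  by apply: eq_integral => w _; rewrite /Psi Phi'E hist_last -EFinM mulrA.
rewrite (expectation_step hX.1 X_law (@measurable_snd _ _ R R) started1 startedS mPsi); last first.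
  by move=> v; rewrite /Psi -EFinM lee_fin !mulr_ge0// surv_ge0.
apply: eq_integral => w _.
have mg : measurable_fun setT (fun u => (\1_(step_set theta a) (u, Z m.+1 w) * surv i u)%:E).
  apply/measurable_EFinP; apply: measurable_funM; last exact: measurable_surv.
  exact: measurable_step_from.
rewrite /Psi/= hist_last ge0_integralZl//; last 2 first.
- by move=> u _; rewrite lee_fin mulr_ge0// surv_ge0.
- by rewrite lee_fin.
rewrite EFinM; have [->|nz] := eqVneq (Phi (hist Z m w)) 0; first by rewrite !mul0e.
congr (_ * _)%E; rewrite step_integral ?PhiJ//.
- exact: measurable_surv.
- by move=> u; exact: surv_ge0.
- exact: (surv_chain theta b1 c0 i).1.
Qed.

Lemma Omega_steps n : Omega theta a Z n = steps 0 n.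
Proof. by apply/seteqP; split=> w h i hi; apply: h. Qed.

Lemma prob_OmegaE n : P (Omega theta a Z n) = (surv n y)%:E.
Proof.
have := @survival n 0 (fun=> 1) (measurable_cst _) (fun=> ler01) (fun _ _ => yJ).
rewrite Omega_steps; under eq_integral do rewrite mul1r.
rewrite integral_indic ?setIT//; last exact: measurable_steps.
move=> ->; under eq_integral do rewrite mul1r started1.
by rewrite integral_cst//= probability_setT mule1.
Qed.

End Process.
End Survival.

(** * The limit chain *)
Section LimitProcess.
Context {R : realType}.
Variables (theta a : R).
Hypotheses (theta1 : theta < 1) (a1 : -1 < a).
Local Notation b := (left_end theta a).
Local Notation t := (cutoff theta a).
Local Notation c := (a + 1)^-1.
Local Notation unif := (uniform_law a1).
Local Notation surv := (surv theta b c).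
Variables (lambda : R) (h : R -> R).
Hypothesis pp : perron_pair theta b c lambda h.
Local Notation quantile := (quantile theta a h).

Let b1 : b < 1 := left_end_lt1 theta a1.
Let c0 : 0 < c := width_inv_gt0 a1.
Let lambda0 : 0 < lambda := pp_lambda pp.
Let hi : on_int b h. Proof. by apply: mono_on_int (pp_mono pp); exact: ltW. Qed.
Let mq : measurable_fun setT quantile := measurable_quantile a1 pp.
Let mh : measurable_fun setT h := measurable_perron a1 pp.
Let h0 x : 0 <= h x := perron_ge0 a1 pp x.

Context d (T : measurableType d) (P : probability T R) (X : nat -> {RV P >-> R}).
Hypothesis hX : iid_uniform a1 X.
Variable y : R.
Hypothesis sy : state_space theta t y.

Let yJ : y \in `[b, 1]. Proof. by case/state_spaceE: sy. Qed.
Let ty : theta * y < 1. Proof. by case/state_spaceE: sy. Qed.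
Let hy : 0 < h y. Proof. exact: (pp_gt0 pp). Qed.
Let Z := started_at X y.
Let Z1 w : Z 1%N w = y. Proof. by []. Qed.
Let ZS k w : Z k.+2 w = snd (Z k.+1 w, X k.+2 w). Proof. by []. Qed.
Let mZ k : measurable_fun setT (Z k.+1).
Proof. exact: (measurable_driven (@measurable_snd _ _ R R) Z1 ZS). Qed.
Let mHZ k : measurable_fun setT (hist Z k).
Proof. exact: (measurable_hist (@measurable_snd _ _ R R) Z1 ZS). Qed.
Let XL := X_law hX.

Fixpoint limit_process k w : R :=
  match k with
  | 0%N => y
  | k'.+1 => if k' is 0%N then y else quantile (limit_process k' w, X k w)
  end.
Local Notation Y := limit_process.

Let Y1 w : Y 1%N w = y. Proof. by []. Qed.
Let YS k w : Y k.+2 w = quantile (Y k.+1 w, X k.+2 w). Proof. by []. Qed.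

Lemma limit_process_state k w : state_space theta t (Y k w).
Proof.
case: k => [|k] //; elim: k => [|k IH] //.
by rewrite YS; exact: (quantile_state theta1 a1 pp).
Qed.

Lemma measurable_limit_process k : measurable_fun setT (Y k).
Proof.
case: k => [|k]; first exact: measurable_cst.
exact: (measurable_driven mq Y1 YS).
Qed.

Let mHY k : measurable_fun setT (hist Y k).
Proof. exact: (measurable_hist mq Y1 YS). Qed.

(** The indicator of [Omega m] as a function of the path. *)
Fixpoint allowed m : m.+1.-tuple R -> R :=
  match m with
  | 0%N => fun=> 1
  | m'.+1 => fun z => allowed (init z) *
      \1_(step_set theta a) (last_state z, last_state (init z))
  end.

Lemma allowed_ge0 m (z : m.+1.-tuple R) : 0 <= allowed z.
Proof. by elim: m z => [//|m IH] z /=; rewrite mulr_ge0. Qed.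

Let mS : measurable_fun setT (\1_(step_set theta a) : R * R -> R).
Proof. by apply: measurable_indic; exact: measurable_step_set. Qed.

Lemma measurable_allowed m : measurable_fun setT (@allowed m).
Proof.
elim: m => [|m IH]; first exact: measurable_cst.
apply: measurable_funM; first exact: (measurableT_comp IH (@measurable_init R m.+1)).
apply: (measurableT_comp mS); apply: measurable_fun_pair; first exact: measurable_last.
exact: (measurableT_comp (@measurable_last R m) (@measurable_init R m.+1)).
Qed.

Lemma allowed_hist m w : allowed (hist Z m.+1 w) =
  allowed (hist Z m w) * \1_(step_set theta a) (Z m.+2 w, Z m.+1 w).
Proof. by rewrite /= [in init _]hist_extend init_extend !hist_last. Qed.

Lemma allowed_J m w : allowed (hist Z m w) != 0 -> Z m.+1 w \in `[b, 1].
Proof.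
elim: m => [//|m IH]; rewrite allowed_hist mulf_eq0 negb_or => /andP[/IH ZJ].
rewrite indicE; case: (boolP (_ \in _)) => [|_]; last by rewrite eqxx.
by rewrite inE => /(step_setE _ ZJ)[].
Qed.

Lemma allowed_steps m w : allowed (hist Z m w) = \1_(steps theta a X y 0 m) w.
Proof.
elim: m => [|m IH]; first by rewrite steps0 indicT.
rewrite allowed_hist IH !indicE.
have E : steps theta a X y 0 m.+1 w <->
    steps theta a X y 0 m w /\ step_set theta a (Z m.+2 w, Z m.+1 w).
  split=> [h1|[h1 h2] l].
    split; last by apply: (h1 m.+1); rewrite /= add0n.
    by move=> l /andP[l0 lm]; apply: h1; rewrite l0 /= (leq_trans lm).
  rewrite add0n => /andP[l0]; rewrite leq_eqVlt => /predU1P[->//|lm].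
  by apply: h1; rewrite l0 add0n.
have [s|ns] := pselect (steps theta a X y 0 m.+1 w).
  by rewrite (mem_set s); have [s1 s2] := E.1 s; rewrite !mem_set// mulr1.
rewrite (memNset ns); have [s1|n1] := pselect (steps theta a X y 0 m w); last first.
  by rewrite (memNset n1) mul0r.
have [s2|n2] := pselect (step_set theta a (Z m.+2 w, Z m.+1 w)).
  by case: ns; apply/E.
by rewrite (memNset n2) mulr0.
Qed.

Let kern (g : R -> \bar R) x : state_space theta t x -> measurable_fun setT g ->
  (forall v, 0 <= g v)%E ->
  (\int[unif]_u g (quantile (x, u)) = \int[unif]_v (g v * (tilt theta a lambda h x v)%:E))%E.
Proof.
move=> sx mg g0.
have E : (\int[push_kernel unif mq x]_v g v =
    \int[density unif (measurable_tilt a1 pp x) (tilt_ge0 a1 pp x)]_v g v)%E.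
  apply: eq_measure_integral => B mB _.
  exact: (quantile_law theta1 a1 pp sx mB).
rewrite -(ge0_integral_density unif (measurable_tilt a1 pp x) (tilt_ge0 a1 pp x) mg g0) -E.
exact/esym/(ge0_integral_distribution (push_fun mq x) mg g0).
Qed.

(** The chain [Y] is the [h]-transform of the sequence [Z] killed at the first
    forbidden step: the factors [h(x_(k+1)) / (lambda h(x_k))] of the steps telescope. *)
Lemma tilted_law m (Phi : m.+1.-tuple R -> \bar R) : measurable_fun setT Phi ->
  (forall z, 0 <= Phi z)%E ->
  (\int[P]_w Phi (hist Y m w) = (lambda ^- m / h y)%:E *
   \int[P]_w (Phi (hist Z m w) * (allowed (hist Z m w) * h (Z m.+1 w))%:E))%E.
Proof.
elim: m Phi => [|m IH] Phi mPhi Phi0.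
  have H w : hist Y 0 w = hist Z 0 w.
    by apply: eq_from_tnth => i; rewrite !tnth_mktuple ord1.
  have H2 w : hist Z 0 w = [tuple y | i < 1].
    by apply: eq_from_tnth => i; rewrite !tnth_mktuple ord1.
  under eq_integral do rewrite H H2.
  under [X in (_ * X)%E]eq_integral do rewrite H2 Z1 /= mul1r.
  rewrite !integral_cst//= probability_setT !mule1 expr0 invr1 div1r.
  by rewrite muleCA -EFinM mulVf ?mule1// gt_eqF.
have mext : measurable_fun setT (fun zu : m.+1.-tuple R * R => Phi (extend zu.1 zu.2)).
  exact: (measurableT_comp mPhi (@measurable_extend R m.+1)).
have ml : measurable_fun setT (fun zu : m.+1.-tuple R * R => last_state zu.1).
  exact: (measurableT_comp (@measurable_last R m) measurable_fst).
have mqz : measurable_fun setT (fun zu : m.+1.-tuple R * R => quantile (last_state zu.1, zu.2)).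
  by apply: (measurableT_comp mq); exact: measurable_fun_pair.
pose Psi (zu : m.+1.-tuple R * R) := Phi (extend zu.1 (quantile (last_state zu.1, zu.2))).
have mPsi : measurable_fun setT Psi.
  have m4 : measurable_fun setT
      (fun zu : m.+1.-tuple R * R => (zu.1, quantile (last_state zu.1, zu.2))).
    exact: measurable_fun_pair.
  exact: (measurableT_comp mext m4).
transitivity (\int[P]_w Psi (hist Y m w, X m.+2 w))%E.
  by apply: eq_integral => w _; rewrite /Psi/= hist_extend YS hist_last.
rewrite (expectation_step hX.1 XL mq Y1 YS mPsi (fun v => Phi0 _)).
pose Phi' z := (\int[unif]_u Psi (z, u))%E.
have Psi0 v : (0 <= Psi v)%E by exact: Phi0.
have mPhi' : measurable_fun setT Phi'.
  exact: (measurable_fun_fubini_tonelli_F (m2 := unif) Psi mPsi Psi0).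
have Phi'0 z : (0 <= Phi' z)%E by exact: integral_ge0.
rewrite [LHS](IH Phi' mPhi' Phi'0).
pose Theta (zu : m.+1.-tuple R * R) : \bar R := (Phi (extend zu.1 zu.2) *
  (allowed zu.1 * (\1_(step_set theta a) (zu.2, last_state zu.1) * h zu.2))%:E)%E.
have mTheta : measurable_fun setT Theta.
  apply: emeasurable_funM => //; apply/measurable_EFinP; apply: measurable_funM.
    exact: (measurableT_comp (@measurable_allowed m) measurable_fst).
  apply: measurable_funM; last exact: (measurableT_comp mh measurable_snd).
  by apply: (measurableT_comp mS); exact: measurable_fun_pair.
have Theta0 v : (0 <= Theta v)%E.
  by rewrite mule_ge0// lee_fin !mulr_ge0// allowed_ge0.
have -> : (\int[P]_w (Phi (hist Z m.+1 w) * (allowed (hist Z m.+1 w) * h (Z m.+2 w))%:E) =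
    \int[P]_w Theta (hist Z m w, X m.+2 w))%E.
  by apply: eq_integral => w _; rewrite allowed_hist /Theta hist_extend hist_last mulrA.
rewrite (expectation_step hX.1 XL (@measurable_snd _ _ R R) Z1 ZS mTheta Theta0).
have mT w : measurable_fun setT (fun u => Theta (hist Z m w, u)).
  by apply: (measurableT_comp mTheta); exact: measurable_fun_pair.
(* Points with [h = 0] have no successor, so that both sides vanish there. *)
have key w : (Phi' (hist Z m w) * (allowed (hist Z m w) * h (Z m.+1 w))%:E =
    lambda^-1%:E * \int[unif]_u Theta (hist Z m w, u))%E.
  have [al0|aln] := eqVneq (allowed (hist Z m w)) 0.
    rewrite al0 mul0r mule0 /Theta/= al0.
    by under eq_integral do rewrite mul0r mule0; rewrite integral0 mule0.
  have ZJ := allowed_J aln.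
  have [tZ|tZ] := ltP (theta * Z m.+1 w) 1; last first.
    rewrite (perron_vanish pp tZ) mulr0 mule0 /Theta/= hist_last.
    under eq_integral => u _.
      rewrite indicE memNset; last first.
        move=> /(step_setE _ ZJ)[uJ]; rewrite ltNge; move: uJ; rewrite in_itv/= => /andP[_ u1].
        by rewrite (le_trans u1).
      rewrite mul0r mulr0 mule0; over.
    by rewrite integral0 mule0.
  have sZ : state_space theta t (Z m.+1 w) by apply/state_spaceE.
  have hZ : 0 < h (Z m.+1 w) by exact: (pp_gt0 pp).
  have mg : measurable_fun setT (fun v => Phi (extend (hist Z m w) v)).
    by apply: (measurableT_comp mext (g := fun v => (hist Z m w, v))); exact: measurable_fun_pair.
  rewrite /Phi' /Psi /= hist_last (kern sZ mg)//.
  rewrite muleC -ge0_integralZl//; last 3 first.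
  - by apply: emeasurable_funM => //; apply/measurable_EFinP; exact: measurable_tilt.
  - by move=> v _; rewrite mule_ge0// lee_fin (tilt_ge0 a1 pp).
  - by rewrite lee_fin mulr_ge0// allowed_ge0.
  rewrite -ge0_integralZl//; last by rewrite lee_fin invr_ge0 ltW.
  apply: eq_integral => v _; rewrite /Theta /= hist_last muleCA [RHS]muleCA -!EFinM.
  congr (_ * _%:E)%E; rewrite /tilt; field; rewrite !gt_eqF//.
have mF := measurable_fun_fubini_tonelli_F (m2 := unif) Theta mTheta Theta0.
have mI : measurable_fun setT (fun w => \int[unif]_u Theta (hist Z m w, u))%E.
  exact: (measurableT_comp mF (@mHZ m)).
under eq_integral do rewrite key.
rewrite ge0_integralZl//; last 2 first.
- by move=> w _; exact: integral_ge0.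
- by rewrite lee_fin invr_ge0 ltW.
rewrite muleA -EFinM; congr (_%:E * _)%E.
by rewrite exprS invfM; ring.
Qed.

Let s1 n : 0 < surv n 1. Proof. exact: surv1_gt0. Qed.

Definition limit_chain k : {RV P >-> R} := HB.pack (Y k)
  (isMeasurableFun.Build _ _ _ _ _ (measurable_limit_process k)).

Lemma limit_markov :
  markov_chain (state_space theta t) y (push_pker unif mq) limit_chain.
Proof.
split => [k w _|w|k A B].
- exact: limit_process_state.
- by [].
case: k A => [//|k] A _ mA mB past.
have pastE : past = hist Y k @^-1` A by [].
have mpast : measurable past.
  by rewrite pastE -[X in measurable X]setTI; exact: mHY.
have mYB : measurable (Y k.+2 @^-1` B).
  rewrite -[X in measurable X]setTI.
  exact: measurable_limit_process.
have mA1 : measurable_fun setT (\1_A : k.+1.-tuple R -> R) by exact: measurable_indic.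
have mB1 : measurable_fun setT (\1_B : R -> R) by exact: measurable_indic.
pose Psi (zu : k.+1.-tuple R * R) : \bar R :=
  ((\1_A zu.1 : R)%:E * (\1_B (quantile (last_state zu.1, zu.2)) : R)%:E)%E.
have ml : measurable_fun setT (fun zu : k.+1.-tuple R * R => last_state zu.1).
  exact: (measurableT_comp (@measurable_last R k) measurable_fst).
have mqz : measurable_fun setT (fun zu : k.+1.-tuple R * R => quantile (last_state zu.1, zu.2)).
  by apply: (measurableT_comp mq); exact: measurable_fun_pair.
have mPsi : measurable_fun setT Psi.
  apply: emeasurable_funM; apply/measurable_EFinP.
    exact: (measurableT_comp mA1 measurable_fst).
  exact: (measurableT_comp mB1 mqz).
have Psi0 v : (0 <= Psi v)%E by rewrite /Psi -EFinM lee_fin mulr_ge0.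
have -> : P (past `&` limit_chain k.+2 @^-1` B) = (\int[P]_w Psi (hist Y k w, X k.+2 w))%E.
  rewrite -[past `&` _]setIT -integral_indic//; last exact: measurableI.
  apply: eq_integral => w _; rewrite /Psi /= hist_last -YS -EFinM; congr EFin.
  rewrite !indicE -natrM mulnb; congr (nat_of_bool _)%:R; apply/idP/idP.
    by rewrite inE => -[h1 h2]; rewrite !mem_set.
  by move=> /andP[]; rewrite !inE.
rewrite (expectation_step hX.1 (X_law hX) mq Y1 YS mPsi Psi0).
rewrite [RHS]integral_mkcond; apply: eq_integral => w _; rewrite patchE.
have mBq : measurable [set u | B (quantile (Y k.+1 w, u))].
  rewrite -[X in measurable X]setTI.
  exact: (measurable_section mq (Y k.+1 w) measurableT mB).
rewrite /Psi/= hist_last; case: ifPn => [|wp].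
  rewrite inE => wp; rewrite indicE mem_set//.
  under eq_integral do rewrite mul1e.
  rewrite (_ : (fun u => (\1_B (quantile (Y k.+1 w, u)))%:E) =
    (fun u => (\1_[set u | B (quantile (Y k.+1 w, u))] u)%:E)).
    by rewrite integral_indic// setIT.
  by apply/funext => u; rewrite !indicE; congr (nat_of_bool _)%:R%:E; apply/idP/idP; rewrite !inE.
rewrite indicE memNset; last by move=> Aw; move/negP: wp; apply; rewrite inE.
by under eq_integral do rewrite mul0e; rewrite integral0.
Qed.

Definition pairs m (z : m.+1.-tuple R) : m.-tuple (R * R) :=
  [tuple (tnth z (lift ord0 k), tnth z (widen_ord (leqnSn m) k)) | k < m].

Lemma pair_block_hist (V : nat -> T -> R) m w : pair_block V m w = pairs (hist V m w).
Proof.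
apply: eq_from_tnth => k; rewrite !tnth_mktuple /=.
by rewrite /bump/= add1n.
Qed.

Lemma measurable_pairs m : measurable_fun setT (@pairs m).
Proof.
apply/measurable_fun_tnthP => k.
rewrite (_ : _ \o _ = fun z => (tnth z (lift ord0 k), tnth z (widen_ord (leqnSn m) k))).
  by apply: measurable_fun_pair; exact: measurable_tnth.
by apply/funext => z /=; rewrite tnth_mktuple.
Qed.

Lemma stepsD m i : steps theta a X y 0 (m + i) = steps theta a X y 0 m `&` steps theta a X y m i.
Proof.
apply/seteqP; split=> w.
  move=> s; split=> l /andP[h1 h2]; apply: s.
    by rewrite h1 add0n (leq_trans h2)// add0n leq_addr.
  by rewrite (leq_ltn_trans _ h1).
move=> [s1' s2] l; rewrite add0n => /andP[h1 h2].
have [lm|ml] := leqP l m; first by apply: s1'; rewrite h1.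
by apply: s2; rewrite ml.
Qed.

(** After division by [surv i 1] the integrals given by [survival] converge by
    dominated convergence, and the quotients [surv (m + i) 1 / surv i 1] tend to
    [lambda ^+ m]; the result is the expression in [tilted_law]. *)
Lemma cond_prob_cvg m (A : set (m.-tuple (R * R))) : measurable A ->
  cond_prob_block P X theta a y n A @[n --> \oo] --> fine (P (pair_block Y m @^-1` A)).
Proof.
move=> mA.
have mA1 : measurable_fun setT (\1_A : m.-tuple (R * R) -> R) by exact: measurable_indic.
pose Phi (z : m.+1.-tuple R) : R := \1_A (pairs z) * allowed z.
have mAp : measurable_fun setT (fun z : m.+1.-tuple R => \1_A (pairs z) : R).
  exact: (measurableT_comp mA1 (@measurable_pairs m)).
have mPhi : measurable_fun setT Phi.
  by apply: measurable_funM => //; exact: measurable_allowed.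
have Phi0 z : 0 <= Phi z by rewrite mulr_ge0// allowed_ge0.
have PhiJ w : Phi (hist Z m w) != 0 -> Z m.+1 w \in `[b, 1].
  by rewrite mulf_eq0 negb_or => /andP[_]; exact: allowed_J.
have Phi1 w : Phi (hist Z m w) <= 1.
  rewrite /Phi allowed_steps !indicE -natrM mulnb.
  by case: (_ && _).
pose e i x := surv i x / surv i 1.
pose F i w := Phi (hist Z m w) * e i (Z m.+1 w).
pose Finf w := Phi (hist Z m w) * h (Z m.+1 w).
have mF i : measurable_fun setT (F i).
  apply: measurable_funM; first exact: (measurableT_comp mPhi (@mHZ m)).
  apply: (measurable_funM (f := fun w => surv i (Z m.+1 w)) (g := fun=> (surv i 1)^-1)) => //.
  exact: (measurableT_comp (@measurable_surv _ theta a a1 i) (@mZ m)).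
have mFinf : measurable_fun setT Finf.
  apply: measurable_funM; first exact: (measurableT_comp mPhi (@mHZ m)).
  exact: (measurableT_comp mh (@mZ m)).
have probE i : fine (P (@pair_block R T Z m @^-1` A `&` Omega theta a Z (m + i))) =
    surv i 1 * \int[P]_w F i w.
  have E : P (@pair_block R T Z m @^-1` A `&` Omega theta a Z (m + i)) =
      (\int[P]_w (Phi (hist Z m w) * \1_(steps theta a X y m i) w)%:E)%E.
    have mpb : measurable (@pair_block R T Z m @^-1` A).
      rewrite (_ : _ @^-1` _ = (fun w => pairs (hist Z m w)) @^-1` A).
        rewrite -[X in measurable X]setTI.
        by have := measurableT_comp (@measurable_pairs m) (@mHZ m); apply.
      by apply/seteqP; split=> w /=; rewrite pair_block_hist.
    have mO : measurable (Omega theta a Z (m + i)).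
      by rewrite Omega_steps; exact: measurable_steps.
    rewrite -[_ `&` _]setIT -integral_indic//; last exact: measurableI.
    apply: eq_integral => w _; congr EFin.
    rewrite /Phi allowed_steps Omega_steps stepsD !indicE.
    rewrite -!natrM !mulnb; congr (nat_of_bool _)%:R; apply/idP/idP.
      by rewrite inE => -[/=]; rewrite pair_block_hist => h1 [h2 h3]; rewrite !mem_set.
    move=> /andP[/andP[]]; rewrite !inE => h1 h2 h3; split => //=.
    by rewrite pair_block_hist.
  rewrite E (survival hX)//.
  have -> : (\int[P]_w (Phi (hist Z m w) * surv i (Z m.+1 w))%:E =
      (surv i 1)%:E * \int[P]_w (F i w)%:E)%E.
    rewrite -ge0_integralZl//.
    - apply: eq_integral => w _; rewrite -EFinM /F /e; congr EFin; field.
      by rewrite gt_eqF.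
    - exact/measurable_EFinP.
    - move=> w _; rewrite lee_fin; apply: mulr_ge0 => //.
      by apply: divr_ge0; [exact: surv_ge0|exact: ltW].
    - by rewrite lee_fin ltW.
  rewrite /Rintegral; case: (\int[P]_w (F i w)%:E)%E => [r||] //=.
  + by rewrite gt0_muley ?lte_fin//= mulr0.
  + by rewrite gt0_muleNy ?lte_fin//= mulr0.
have [B [N [B0 hB]]] := pp_bound pp.
have Fbound i w : `|F (i + N)%N w| <= B.
  have [z|nz] := eqVneq (Phi (hist Z m w)) 0; first by rewrite /F z mul0r normr0.
  have ZJ := PhiJ w nz.
  have e0 : 0 <= e (i + N)%N (Z m.+1 w) by apply: divr_ge0; [exact: surv_ge0|exact: ltW].
  rewrite ger0_norm; last by rewrite mulr_ge0.
  apply: (@le_trans _ _ (1 * e (i + N)%N (Z m.+1 w))); first by rewrite ler_wpM2r.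
  by rewrite mul1r; apply: hB => //; exact: leq_addl.
have Fcvg w : F (i + N)%N w @[i --> \oo] --> Finf w.
  have [z|nz] := eqVneq (Phi (hist Z m w)) 0.
    rewrite /Finf z mul0r (_ : (fun i => F (i + N)%N w) = fun=> 0); first exact: cvg_cst.
    by apply/funext => i; rewrite /F z mul0r.
  apply: cvgMr; rewrite (cvg_shiftn N (e ^~ (Z m.+1 w))).
  by apply: (pp_cvg pp); exact: PhiJ.
have Bint : P.-integrable setT (EFin \o cst B) by exact: finite_measure_integrable_cst.
have Finfb w : `|Finf w| <= B.
  have cv : `|F (i + N)%N w| @[i --> \oo] --> `|Finf w| by apply: cvg_norm; exact: Fcvg.
  by apply: (cvgn_le cv) => i; exact: Fbound.
have Finfi : P.-integrable setT (EFin \o Finf).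
  apply: le_integrable Bint => //; first exact/measurable_EFinP.
  by move=> w _ /=; rewrite lee_fin (le_trans (Finfb w))// ler_norm.
have Jcvg : \int[P]_w F i w @[i --> \oo] --> \int[P]_w Finf w.
  rewrite -(cvg_shiftn N).
  have key : ((\int[P]_w (EFin \o F (i + N)%N) w)%E @[i --> \oo] -->
      (\int[P]_w (EFin \o Finf) w)%E)%E.
    apply: (@dominated_cvg _ _ _ P _ measurableT _ _ (EFin \o cst B)) => //.
    - by move=> i; exact/measurable_EFinP.
    - by move=> w _; apply: cvg_EFin; [exact: nearW|exact: Fcvg].
    - by move=> i w _ /=; rewrite lee_fin.
  have ffin := integrable_fin_num measurableT Finfi.
  by rewrite -(fineK ffin) in key; move/fine_cvgP : key => [].
have rate k : surv (k + i)%N 1 / surv i 1 @[i --> \oo] --> lambda ^+ k.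
  elim: k => [|k IH].
    rewrite expr0 (_ : (fun i => _) = fun=> 1); first exact: cvg_cst.
    by apply/funext => i; rewrite add0n divff// gt_eqF.
  have c1 : surv (k + i).+1 1 / surv (k + i)%N 1 @[i --> \oo] --> lambda.
    rewrite (_ : (fun i => _) = (fun i => surv (i + k).+1 1 / surv (i + k)%N 1)); last first.
      by apply/funext => i; rewrite addnC.
    by have := pp_rate pp; rewrite -(cvg_shiftn k).
  rewrite exprS (_ : (fun i => _) = (fun i =>
    (surv (k + i).+1 1 / surv (k + i)%N 1) * (surv (k + i)%N 1 / surv i 1))); last first.
    by apply/funext => i; rewrite addSn mulrA divfK// gt_eqF.
  exact: cvgM.
have ecvg : e (i + m)%N y @[i --> \oo] --> h y.
  by rewrite (cvg_shiftn m (e ^~ y)); exact: (pp_cvg pp).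
have condE i : cond_prob_block P X theta a y (i + m) A =
    \int[P]_w F i w * (surv (m + i)%N 1 / surv i 1)^-1 * (e (i + m)%N y)^-1.
  rewrite /cond_prob_block /prob_Omega (prob_OmegaE hX yJ)/= [(i + m)%N]addnC probE /e.
  have sy0 : 0 < surv (m + i) y by apply: surv_gt0.
  by field; rewrite !gt_eqF.
rewrite -(cvg_shiftn m).
under eq_fun do rewrite condE.
have -> : fine (P (pair_block Y m @^-1` A)) =
    \int[P]_w Finf w * (lambda ^+ m)^-1 * (h y)^-1.
  have -> : P (pair_block Y m @^-1` A) = (\int[P]_w (\1_A (pairs (hist Y m w)))%:E)%E.
    have mpb : measurable (@pair_block R T Y m @^-1` A).
      rewrite (_ : _ @^-1` _ = (fun w => pairs (hist Y m w)) @^-1` A).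
        rewrite -[X in measurable X]setTI.
        by have := measurableT_comp (@measurable_pairs m) (@mHY m); apply.
      by apply/seteqP; split=> w /=; rewrite pair_block_hist.
    rewrite -[_ @^-1` _]setIT -integral_indic//.
    apply: eq_integral => w _; congr EFin; rewrite !indicE; congr (nat_of_bool _)%:R.
    by apply/idP/idP; rewrite !inE /= pair_block_hist.
  have mPe : measurable_fun setT (fun z : m.+1.-tuple R => (\1_A (pairs z) : R)%:E).
    exact/measurable_EFinP.
  rewrite (tilted_law mPe); last by move=> z; rewrite lee_fin.
  have -> : (\int[P]_w ((\1_A (pairs (hist Z m w)))%:E *
      (allowed (hist Z m w) * h (Z m.+1 w))%:E) = \int[P]_w (Finf w)%:E)%E.
    by apply: eq_integral => w _; rewrite -EFinM mulrA.
  have ffin := integrable_fin_num measurableT Finfi.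
  by rewrite -(fineK ffin) -EFinM/= /Rintegral; ring.
apply: cvgM; last by apply: cvgV; rewrite ?gt_eqF.
apply: cvgM => //; apply: cvgV; last exact: rate.
by rewrite gt_eqF// exprn_gt0.
Qed.

Lemma prob_Omega_gt0 n : 0 < prob_Omega P X theta a y n.
Proof.
by rewrite /prob_Omega (prob_OmegaE hX yJ)/=; exact: surv_gt0.
Qed.

End LimitProcess.

Unset Implicit Arguments.
Set Strict Implicit.
Set Printing Implicit Defensive.

Theorem theorem1p1 (R : realType) (d : measure_display) (T : measurableType d)
    (P : probability T R) (theta a : R) (X : nat -> {RV P >-> R})
    (htheta : -1 <= theta < 1) (ha : -1 < a) (hX : iid_uniform ha X) :
  exists t : R, (t = a \/ (theta != 0 /\ t = - theta^-1) \/ t = 0) /\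
  exists (lambda : R) (h : R -> R),
    [/\ 0 < lambda,
        largest_eigenvalue theta a t lambda,
        eigenfunction theta a t lambda h,
        (forall x, state_space theta t x -> 0 < h x) &
        (forall g, eigenfunction theta a t lambda g ->
           exists c : R, forall x, g x = c * h x)] /\
  exists p : R.-pker R ~> R,
    (forall x (B : set R), state_space theta t x -> measurable B ->
       p x B = reduced_kernel theta a t lambda h x B) /\
    forall y : R, state_space theta t y ->
      (forall n, 0 < prob_Omega P X theta a y n) /\
      exists (d' : measure_display) (T' : measurableType d')
        (Q : probability T' R) (Y : nat -> {RV Q >-> R}),
        markov_chain (state_space theta t) y p Y /\
        forall (m : nat) (A : set (m.-tuple (R * R))), measurable A ->
          cond_prob_block P X theta a y n A @[n --> \oo] -->
            fine (Q (@pair_block R T' Y m @^-1` A)).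
Proof.
have /andP[_ theta1] := htheta.
have [lambda [h pp]] := perron (left_end_lt1 theta ha) (width_inv_gt0 ha) theta1
  (left_end_sgn theta a).
exists (cutoff theta a); split; first exact: cutoff_cases.
exists lambda, h; split.
  split.
  - exact: (pp_lambda pp).
  - exact: (perron_largest ha pp).
  - exact: (perron_eigenfunction ha pp).
  - by move=> x /(state_spaceE theta1 ha)[xJ tx]; exact: (pp_gt0 pp).
  - by move=> g; exact: (perron_unique ha pp).
exists (push_pker (uniform_law ha) (measurable_quantile ha pp)); split.
  move=> x B sx mB; rewrite push_pkerE (quantile_law theta1 ha pp sx mB).
  exact: (tilt_reduced_kernel theta1 ha pp sx mB).
move=> y sy; split; first by move=> n; exact: (prob_Omega_gt0 theta1 hX sy).
exists d, T, P, (limit_chain ha pp X y); split.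
  exact: (limit_markov theta1 pp hX sy).
move=> m A mA.
exact: (cond_prob_cvg theta1 pp hX sy mA).
Qed.
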